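(* For every $d\in\mathbb{N}$ and $\ell\in\mathbb{N}$ there is a constant $C$, depending only on $d$ and $\ell$, such that for every $d$-simplex $K\subset\mathbb{R}^d$ and every $v\in H^1(K)$ \[ e(v,K)\le C\,\underline{e}(v,K), \qquad\text{where}\quad \underline{e}(v,K):=\Big(\sum_{i=1}^d\inf_{R\in\mathcal{P}_{\ell-1}(K)}\|\partial_iv-R\|_{L^2(K)}^2\Big)^{1/2} =\inf_{Q\in\mathcal{P}_{\ell-1}(K)^d}\|\nabla v-Q\|_{L^2(K)}. \]
   Context: $\mathcal{P}_m(K)$ denotes polynomials of total degree $\le m$ on $K$, and $e(v,K):=\inf_{P\in\mathcal{P}_\ell(K)}\|\nabla(v-P)\|_{L^2(K)}$, where $\|f\|_{L^2(K)}=(\int_K|f|^2)^{1/2}$ with $|\cdot|$ the Euclidean norm for vector fields. *)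

(* Defs.v *)
From HB Require Import structures.
From mathcomp Require Import all_boot all_order all_algebra.
From mathcomp Require Import all_classical all_reals all_analysis.
Set Implicit Arguments. Unset Strict Implicit. Unset Printing Implicit Defensive.
Import Order.TTheory GRing.Theory Num.Theory.
Import numFieldNormedType.Exports.
Local Open Scope classical_set_scope.
Local Open Scope ring_scope.

Section Defs.
Variable R : realType.

Definition row_of_tuple d (t : d.-tuple R) : 'rV[R]_d := \row_i tnth t i.

(* d-dimensional Lebesgue integral of a nonnegative function on d.-tuple R,
   as an iterated one-dimensional Lebesgue integral (Tonelli). *)
Fixpoint iint (n : nat) : (n.-tuple R -> \bar R) -> \bar R :=
  match n with
  | 0 => fun f => f [tuple]
  | n.+1 => fun f =>
      (\int[@lebesgue_measure R]_x iint (fun t => f (cons_tuple x t)))%E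
  end.

Definition intK d (K : set 'rV[R]_d) (f : 'rV[R]_d -> R) : \bar R :=
  iint (fun t : d.-tuple R => (\1_K (row_of_tuple t) * f (row_of_tuple t))%:E).

Definition partial d (i : 'I_d) (f : 'rV[R]_d -> R) : 'rV[R]_d -> R :=
  fun x => 'D_(delta_mx 0 i) f x.

Definition iter_partial d (s : seq 'I_d) (f : 'rV[R]_d -> R) : 'rV[R]_d -> R :=
  foldr (fun i g => partial i g) f s.

Definition smooth d (f : 'rV[R]_d -> R) : Prop :=
  forall s : seq 'I_d, continuous (iter_partial s f) /\
    forall (i : 'I_d) (x : 'rV[R]_d), derivable (iter_partial s f) x (delta_mx 0 i).

Definition test_fun d (K : set 'rV[R]_d) (phi : 'rV[R]_d -> R) : Prop :=
  smooth phi /\ exists S : set 'rV[R]_d,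
    [/\ compact S, S `<=` interior K & forall x, ~ S x -> phi x = 0].

Definition H1_weak_grad d (K : set 'rV[R]_d) (v : 'rV[R]_d -> R)
    (g : 'rV[R]_d -> 'rV[R]_d) : Prop :=
  [/\ measurable_fun [set: d.-tuple R] (v \o @row_of_tuple d),
      (forall i : 'I_d, measurable_fun [set: d.-tuple R]
          (fun t => g (row_of_tuple t) 0 i)),
      (intK K (fun x => (v x ^+ 2)%R) < +oo)%E,
      (intK K (fun x => (\sum_i (g x 0 i) ^+ 2)%R) < +oo)%E &
      forall phi, test_fun K phi -> forall i : 'I_d,
        (* int_K (v d_i phi + g_i phi) = 0 *)
        intK K (fun x => Num.max (v x * partial i phi x + g x 0 i * phi x) 0) =
        intK K (fun x => Num.max (- (v x * partial i phi x + g x 0 i * phi x)) 0)].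

(* P_m(R^d): polynomials of total degree <= m (m : int; P_m = {0} for m < 0). *)
Definition is_poly d (m : int) (P : 'rV[R]_d -> R) : Prop :=
  exists c : {ffun 'I_d -> 'I_(`|m|%N.+1)} -> R,
    forall x, P x = \sum_(a : {ffun 'I_d -> 'I_(`|m|%N.+1)}
                        | ((\sum_i (a i : nat))%:Z <= m))
                    c a * \prod_i (x 0 i) ^+ (a i).

Definition sqrte (x : \bar R) : \bar R := (x `^ 2^-1)%E.

(* e(v,K) = inf_{P in P_l} || grad v - grad P ||_{L^2(K)}, with g = grad v. *)
Definition err d (l : nat) (K : set 'rV[R]_d) (g : 'rV[R]_d -> 'rV[R]_d) : \bar R :=
  ereal_inf [set sqrte (intK K (fun x => \sum_i (g x 0 i - partial i P x) ^+ 2))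
            | P in [set P | is_poly l%:Z P]].

Definition err_low d (l : nat) (K : set 'rV[R]_d) (g : 'rV[R]_d -> 'rV[R]_d) : \bar R :=
  ereal_inf [set sqrte (intK K (fun x => \sum_i (g x 0 i - Q i x) ^+ 2))
            | Q in [set Q : 'I_d -> 'rV[R]_d -> R |
                    forall i, is_poly (l%:Z - 1) (Q i)]].

Definition affine_indep d (a : 'I_d.+1 -> 'rV[R]_d) : Prop :=
  \det (\matrix_(i < d) (a (lift ord0 i) - a ord0) : 'M[R]_d) != 0.

Definition simplex d (a : 'I_d.+1 -> 'rV[R]_d) : set 'rV[R]_d :=
  [set x | exists lam : 'I_d.+1 -> R,
     [/\ forall i, 0 <= lam i, \sum_i lam i = 1 & x = \sum_i lam i *: a i]].

End Defs.

(* Main.v *)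
Require Import Defs.
From HB Require Import structures.
From mathcomp Require Import all_boot all_order all_algebra.
From mathcomp Require Import all_classical all_reals all_analysis.
From mathcomp Require Import measurable_realfun.
From mathcomp Require Import ring lra.
Set Implicit Arguments. Unset Strict Implicit. Unset Printing Implicit Defensive.
Import Order.TTheory GRing.Theory Num.Theory.
Import numFieldNormedType.Exports.
Local Open Scope classical_set_scope.
Local Open Scope ring_scope.

(* The proof uses averaged Taylor polynomials. Let y_1, ..., y_d be barycentric
   coordinates of K, shifted to vanish at the barycenter, let eta be a smooth
   function of one variable supported near 0 with integral 1 and vanishing
   moments of orders 1, ..., l, and put Psi_b(x) = prod_i eta^(b_i)(y_i(x)),
   Y_b(x) = prod_i y_i(x)^b_i / b_i! for multi-indices b. Integration by parts in
   one variable and Fubini's theorem show that the Y_b and the test functions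
   (-1)^|b| Psi_b / gamma are biorthogonal, gamma being the Jacobian of the
   coordinates, so that
     Pi f = sum_(|b| < l) (-1)^|b| / gamma (int_K f Psi_b) Y_b
   is a projection onto P_(l-1). The same sum over |b| <= l, applied to v, is a
   polynomial P in P_l, and the definition of the weak gradient tested with Psi_b
   gives d_k P = Pi (d_k v) for every k. Finally Pi is bounded on L^2(K) with a
   bound that only involves |K| / gamma, the volume of the reference simplex, hence
   ||d_k v - d_k P|| <= C ||d_k v - Q_k|| for every Q_k in P_(l-1): a single P serves
   all directions k, which makes the estimate insensitive to the shape of K. *)

(** * Compactly supported smooth functions with prescribed moments *)

Section SmoothLine.
Variable R : realType.

(** The obstacle is that the best approximations Q_k of the single components need not form a
    gradient, so they cannot be integrated to a competitor P. One operator Pi applied to every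
    component repairs this because Pi commutes with differentiation. The kernels are closed under
    partial derivatives, d_k Psi_b = sum_j A_kj Psi_(b + e_j) with A the linear part of the
    coordinates, while d_k Y_b lowers indices with the same factors A_kj. Raising an index in the
    weights thus matches lowering it in the Y_b. This is also why P uses one order more than Pi:
    testing with |b| < l produces averages of v of order up to l. The product form of the kernels
    reduces every explicit integral to one-dimensional moments. On the integration side, the
    iterated integral is controlled by Tonelli for nonnegative functions only, so signed integrals
    are assembled from nonnegative ones, and the weak gradient identity, given through positive and
    negative parts, is converted before use. *)

Definition flat (n : nat) (x : R) : R :=
  if 0 < x then x^-1 ^+ n * expR (- x^-1) else 0.

(** At t = 1/x a single term t^(n+2) / (n+2)! of the exponential series is at most exp t. A bound
    quadratic in x is what makes the derivative at the gluing point 0 vanish. *)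
Lemma flat_bound n x : `|flat n x| <= (n.+2)`!%:R * x ^+ 2.
Proof.
rewrite /flat; case: ifPn => [x0|_]; last first.
  by rewrite normr0 mulr_ge0// sqr_ge0.
rewrite ger0_norm; last by rewrite mulr_ge0 ?expR_ge0// exprn_ge0// invr_ge0 ltW.
have t0 : 0 < x^-1 by rewrite invr_gt0.
have := expR_ge1Dxn n.+1 (ltW t0) => h.
have {}h : x^-1 ^+ n.+2 / (n.+2)`!%:R <= expR x^-1 by lra.
rewrite expRN ler_pdivrMr ?expR_gt0//.
have f0 : (0 : R) < (n.+2)`!%:R by rewrite ltr0n fact_gt0.
apply: (@le_trans _ _ ((n.+2)`!%:R * x ^+ 2 * (x^-1 ^+ n.+2 / (n.+2)`!%:R))); last first.
  by rewrite ler_wpM2l// mulr_ge0 ?sqr_ge0// ltW.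
rewrite !exprS le_eqVlt; apply/orP; left; apply/eqP.
by field; rewrite !lt0r_neq0.
Qed.

Lemma is_derive_quadratic_bound (f : R -> R) (C : R) :
  (forall x, `|f x| <= C * x ^+ 2) -> is_derive (0 : R) 1 f 0.
Proof.
move=> fC.
have f0 : f 0 = 0.
  by apply/normr0_eq0/le_anti; rewrite normr_ge0 andbT (le_trans (fC 0))// expr0n mulr0.
have C0 : 0 <= C by have := fC 1; rewrite expr1n mulr1; exact: le_trans.
have cv : h^-1 *: ((f \o shift 0) (h *: 1) - f 0) @[h --> (0:R)^'] --> (0:R).
  apply/cvgrPdist_le => e e0; near=> h.
  have h0 : h != 0 by near: h; exact: nbhs_dnbhs_neq.
  rewrite /= f0 subr0 sub0r normrN addr0 /GRing.scale/= mulr1 normrM normfV.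
  rewrite ler_pdivrMl ?normr_gt0//.
  apply: (le_trans (fC h)).
  rewrite -real_normK ?num_real// expr2 mulrCA ler_wpM2l//.
  have hd : `|h| < e / (C + 1).
    near: h; apply: dnbhs0_lt; rewrite divr_gt0// ltr_wpDl//.
  have : (C + 1) * `|h| <= e by rewrite mulrC -ler_pdivlMr ?ltW// ltr_wpDl.
  by apply: le_trans; rewrite ler_wpM2r// lerDl.
apply: DeriveDef; last exact/cvg_lim.
by apply/cvg_ex; exists 0.
Unshelve. all: by end_near.
Qed.

Lemma is_derive_flat n (x : R) :
  is_derive x 1 (flat n) (flat n.+2 x - n%:R * flat n.+1 x).
Proof.
have [x0|x0|->] := ltrgtP x 0.
- have -> : flat n.+2 x - n%:R * flat n.+1 x = 0.
    by rewrite /flat ltNge (ltW x0)/= mulr0 subr0.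
  apply: (near_eq_is_derive _ (is_derive_cst (0 : R) x (1 : R))).
  have : \forall y \near x, y < 0 by exact: lt_nbhsl.
  by apply: filterS => y y0; rewrite /flat ltNge (ltW y0).
- have dV : is_derive x (1 : R) (fun y : R => y^-1) (- x ^- 2 *: 1).
    by apply: is_deriveV; rewrite gt_eqF.
  have dE := is_derive1_comp (is_derive_expR _) (is_deriveN dV).
  have dX := is_deriveX n dV.
  have /(is_derive_eq (is_deriveM dX dE)) dM : ((fun y : R => y^-1) ^+ n) x *:
      (expR ((- (fun y : R => y^-1)) x) * - (- x ^- 2 *: 1)) +
      (expR \o - (fun y : R => y^-1)) x *:
        ((n%:R * x^-1 ^+ n.-1) *: (- x ^- 2 *: 1)) =
      flat n.+2 x - n%:R * flat n.+1 x.
    rewrite /flat x0 !fctE /= /GRing.scale /=.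
    case: n {dX dE} => [|n] /=; rewrite -!exprVn !exprS ?expr0; ring.
  apply: (near_eq_is_derive _ dM).
  have : \forall y \near x, 0 < y by exact: lt_nbhsr.
  by apply: filterS => y y0; rewrite /flat y0 !fctE.
- have -> : flat n.+2 0 - n%:R * flat n.+1 0 = 0 by rewrite /flat ltxx mulr0 subr0.
  exact: is_derive_quadratic_bound (flat_bound n).
Qed.

(** A syntactic algebra that contains bumps and polynomials and is stable under differentiation. The
    index n of [flat] is what closes it, since the derivative of [flat n] combines [flat n.+1] and
    [flat n.+2]. Derivatives of all orders then come by induction. *)
Inductive smooth1 : (R -> R) -> Prop :=
| smooth1_flat n s c : smooth1 (fun x => flat n (s * x + c))
| smooth1_cst c : smooth1 (cst c)
| smooth1_id : smooth1 id
| smooth1D f g : smooth1 f -> smooth1 g -> smooth1 (f + g)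
| smooth1M f g : smooth1 f -> smooth1 g -> smooth1 (f * g).

Lemma smooth1_ex_derive f : smooth1 f ->
  exists2 g, smooth1 g & forall x : R, is_derive x 1 f (g x).
Proof.
elim=> [n s c|c||{}f g _ [f' sf' df] _ [g' sg' dg]|{}f g sf [f' sf' df] sg [g' sg' dg]].
- exists (cst s * ((fun x => flat n.+2 (s * x + c)) +
    cst (- n%:R) * (fun x => flat n.+1 (s * x + c)))).
    by do !constructor.
  move=> x.
  have dl : is_derive x (1 : R) (fun x : R => s * x + c) s.
    have := is_deriveD (is_deriveZ s (is_derive_id x (1 : R))) (is_derive_cst c x (1 : R)).
    by rewrite addr0 /GRing.scale/= mulr1.
  apply: is_derive_eq (is_derive1_comp (is_derive_flat n _) dl) _.
  by rewrite !fctE /= mulrC mulNr.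
- by exists (cst 0) => [|x]; [constructor|exact: is_derive_cst].
- by exists (cst 1) => [|x]; [constructor|exact: is_derive_id].
- by exists (f' + g') => [|x]; [constructor|exact: is_deriveD].
- exists (f * g' + g * f') => [|x]; first by do !constructor.
  exact: is_deriveM.
Qed.

Lemma smooth1_derive1 f : smooth1 f ->
  smooth1 (derive1 f) /\ forall x : R, is_derive x 1 f (derive1 f x).
Proof.
move=> /smooth1_ex_derive[g sg dg].
have -> : derive1 f = g by apply/funext => x; rewrite derive1E; exact: derive_val.
by [].
Qed.

Lemma smooth1_derive1n f n : smooth1 f -> smooth1 (derive1n n f).
Proof. by move=> sf; elim: n => //= n /smooth1_derive1[]. Qed.

Lemma smooth1X f n : smooth1 f -> smooth1 (f ^+ n).
Proof.
by move=> sf; elim: n => [|n IH]; rewrite ?expr0 ?exprS; constructor.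
Qed.

Lemma smooth1_continuous f : smooth1 f -> continuous f.
Proof.
by move=> /smooth1_ex_derive[g _ dg] x; apply/differentiable_continuous/derivable1_diffP.
Qed.


(** The strict inequality describes an open set, on which f is locally zero, so derivatives inherit
    the property. *)
Definition supported (r : R) (f : R -> R) := forall x, r < `|x| -> f x = 0.

Lemma supported_derive1n r f n : supported r f -> supported r (derive1n n f).
Proof.
move=> f0; elim: n => //= n IH x rx; rewrite derive1E.
have : \near x, (0 : R) = derive1n n f x.
  have rl : \forall y \near x, r < `|y|.
    exact: (@cvgr_norm_gt _ R^o _ (nbhs x) _ id x cvg_id r rx).
  by apply: filterS rl => y /IH.
by move=> /near_eq_is_derive/(_ (is_derive_cst (0 : R) x (1 : R)))/(@derive_val _ _ _ _ _ _ _).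
Qed.

Local Notation mu := (@lebesgue_measure R).

(** The margin 1 puts the endpoints strictly outside [-r, r], where [supported] gives f = 0. The
    boundary terms of the fundamental theorem of calculus then vanish. *)
Lemma integral_supported (r : R) (f : R -> R) : supported r f ->
  (\int[mu]_x (f x)%:E = \int[mu]_(x in `[(- (r + 1))%R, (r + 1)%R]) (f x)%:E)%E.
Proof.
move=> sf; rewrite [RHS]integral_mkcond; apply: eq_integral => x _.
rewrite patchE; case: ifPn => //; rewrite notin_setE/= in_itv/= => /negP h.
rewrite sf// ltNge; apply: contra h; rewrite ler_norml => /andP[h1 h2].
by apply/andP; split; lra.
Qed.

Lemma smooth1_integrable r f : smooth1 f -> supported r f ->
  mu.-integrable setT (EFin \o f).
Proof.
move=> sf rf; have cf := smooth1_continuous sf.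
have mf : measurable_fun [set: R] f by exact: continuous_measurable_fun.
have : mu.-integrable `[- (r + 1), r + 1] (EFin \o f).
  apply: continuous_compact_integrable; first exact: segment_compact.
  exact: continuous_subspaceT.
move=> /integrableP[_ h]; apply/integrableP; split; first exact/measurable_EFinP.
apply: le_lt_trans h; rewrite le_eqVlt; apply/orP; left; apply/eqP.
apply: (@integral_supported r (fun x => `|f x|)) => x /rf ->.
by rewrite normr0.
Qed.

Definition int1 (f : R -> R) : R := \int[mu]_x (f x).

Lemma int1E (r : R) f : smooth1 f -> supported r f ->
  (\int[mu]_x (f x)%:E = (int1 f)%:E)%E.
Proof.
move=> sf rf; rewrite /int1 /Rintegral fineK//.
exact: integrable_fin_num (smooth1_integrable sf rf).
Qed.

Lemma int1_derive1 (r : R) f : 0 < r -> smooth1 f -> supported r f -> int1 (derive1 f) = 0.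
Proof.
move=> r0 sf rf; have [sf' df] := smooth1_derive1 sf.
have rf' : supported r (derive1 f) by exact: (@supported_derive1n r f 1).
rewrite /int1 /Rintegral (integral_supported rf').
rewrite (@continuous_FTC2 _ _ f); first last.
- by move=> x _.
- have cf := smooth1_continuous sf; split.
  + by move=> x _; case: (df x).
  + exact/cvg_at_right_filter/cf.
  + exact/cvg_at_left_filter/cf.
- exact/continuous_subspaceT/smooth1_continuous.
- by lra.
by rewrite !rf ?subee// ?normrN ger0_norm; lra.
Qed.

(** Divided powers: differentiation lowers the index and leaves no coefficient, so moments of
    derivatives are shifted moments. *)
Definition monom (k : nat) : R -> R := fun x => x ^+ k / k`!%:R.

Lemma smooth1_monom k : smooth1 (monom k).
Proof.
rewrite (_ : monom k = id ^+ k * cst (k`!%:R^-1)); last by apply/funext => x; rewrite !fctE.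
by constructor; [apply: smooth1X; constructor|constructor].
Qed.

Lemma derive1_monom k : derive1 (monom k) = if k is k'.+1 then monom k' else cst 0.
Proof.
apply/funext => x; rewrite derive1E.
have dx : is_derive x (1 : R) (monom k) ((k%:R * x ^+ k.-1) / k`!%:R).
  have := is_deriveM (is_deriveX k (is_derive_id x (1 : R))) (is_derive_cst (k`!%:R^-1 : R) x (1 : R)).
  rewrite (_ : id ^+ k * cst _ = monom k); last by apply/funext => y; rewrite !fctE.
  move/is_derive_eq; apply.
  by rewrite !fctE /GRing.scale/=; ring.
rewrite derive_val; case: k {dx} => [|k]; first by rewrite !mul0r.
rewrite /monom/= factS natrM; field.
by rewrite pnatr_eq0 -lt0n fact_gt0 addrC natr1 pnatr_eq0.
Qed.

Lemma supportedMl r f g : supported r f -> supported r (g * f).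
Proof. by move=> rf x /rf; rewrite fctE => ->; rewrite mulr0. Qed.

Lemma int1D r f g : smooth1 f -> supported r f -> smooth1 g -> supported r g ->
  int1 (f + g) = int1 f + int1 g.
Proof.
move=> sf rf sg rg; rewrite /int1; under eq_Rintegral do rewrite fctE.
by rewrite RintegralD//; exact: (@smooth1_integrable r).
Qed.

Lemma int1Z r c f : smooth1 f -> supported r f -> int1 (cst c * f) = c * int1 f.
Proof.
move=> sf rf; rewrite /int1; under eq_Rintegral do rewrite fctE.
by rewrite RintegralZl//; exact: (@smooth1_integrable r).
Qed.

Definition moment k f := int1 (monom k * f).

(** Integration by parts: the derivative of [monom k * f] integrates to zero over the line. *)
Lemma moment_derive1 (r : R) k f : 0 < r -> smooth1 f -> supported r f ->
  moment k (derive1 f) = if k is k'.+1 then - moment k' f else 0.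
Proof.
move=> r0 sf rf; have [sf' df] := smooth1_derive1 sf.
have rf' : supported r (derive1 f) by exact: (@supported_derive1n r f 1).
have [sm' dm] := smooth1_derive1 (smooth1_monom k).
have dE : derive1 (monom k * f) = monom k * derive1 f + derive1 (monom k) * f.
  apply/funext => x; rewrite derive1E (@derive_val _ _ _ _ _ _ _ (is_deriveM (dm x) (df x))).
  by rewrite !fctE /GRing.scale/= [f x * _]mulrC.
have := int1_derive1 r0 (smooth1M (smooth1_monom k) sf) (@supportedMl r _ _ rf).
rewrite dE (@int1D r); first last.
- exact: supportedMl.
- exact: smooth1M.
- exact: supportedMl.
- by constructor => //; exact: smooth1_monom.
move/eqP; rewrite addr_eq0 => /eqP; rewrite /moment => ->.
rewrite derive1_monom; case: k {sm' dm dE} => // .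
by rewrite (@int1Z r)// mul0r oppr0.
Qed.

Lemma moment_derive1n (r : R) k b f : 0 < r -> smooth1 f -> supported r f ->
  moment k (derive1n b f) = if (b <= k)%N then (-1) ^+ b * moment (k - b) f else 0.
Proof.
move=> r0 sf rf; elim: b k => [|b IH] k; first by rewrite expr0 mul1r subn0.
rewrite /= (@moment_derive1 r)//; first last.
- exact: supported_derive1n.
- exact: smooth1_derive1n.
case: k => // k; rewrite IH ltnS subSS; case: ifP => _; last by rewrite oppr0.
by rewrite exprS mulN1r mulNr.
Qed.

Lemma moment_sum r k n (F : 'I_n -> R -> R) :
  (forall i, smooth1 (F i)) -> (forall i, supported r (F i)) ->
  [/\ smooth1 (\sum_i F i), supported r (\sum_i F i) &
  moment k (\sum_i F i) = \sum_i moment k (F i)].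
Proof.
move=> sF rF; apply: (big_rec2 (fun f c => [/\ smooth1 f, supported r f & moment k f = c])).
  split; [exact: smooth1_cst|by []|].
  by rewrite /moment mulr0 /int1 /Rintegral integral0.
move=> i c f _ [sf rf <-]; split; first exact: smooth1D.
  by move=> x rx; rewrite fctE rF// rf// addr0.
rewrite /moment mulrDr (@int1D r)//; first [exact: supportedMl|apply: smooth1M => //; exact: smooth1_monom].
Qed.

Lemma exists_bump (r : R) : 0 < r ->
  exists f, [/\ smooth1 f, supported r f & int1 f != 0].
Proof.
move=> r0; pose f : R -> R := (fun x => flat 0 (1 * x + r)) * (fun x => flat 0 (-1 * x + r)).
have sf : smooth1 f by do !constructor.
have rf : supported r f.
  move=> x; rewrite /f fctE /flat.
  have [x0|x0] := leP 0 x; rewrite ?(ger0_norm x0) ?(ltr0_norm x0) => rx.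
    by rewrite [X in _ * X]ifF ?mulr0//; apply/negbTE; rewrite -leNgt; lra.
  by rewrite ifF ?mul0r//; apply/negbTE; rewrite -leNgt; lra.
exists f; split=> //; apply: lt0r_neq0.
have mf : measurable_fun [set: R] f.
  by have cf := smooth1_continuous sf; exact: continuous_measurable_fun.
have f0 x : 0 <= f x.
  rewrite /f fctE /flat.
  by apply: mulr_ge0; case: ifP => // _; rewrite expr0 mul1r expR_ge0.
(* This is the value of [flat 0] at r / 2. On [-r/2, r/2] both factors of f have an argument of at
   least r / 2, so f is at least [c ^+ 2] there and its integral is positive. *)
pose c := expR (- (r / 2)^-1).
have c0 : 0 < c by exact: expR_gt0.
suff : ((0 : \bar R) < (int1 f)%:E)%E by rewrite lte_fin.
rewrite -(int1E sf rf).
apply: (@lt_le_trans _ _ (\int[mu]_(x in `[(- (r / 2))%R, (r / 2)%R]) (c ^+ 2)%:E)%E).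
  rewrite integral_cst//= lebesgue_measure_itv/= lte_fin ifT; last by lra.
  by rewrite -EFinD -EFinM lte_fin mulr_gt0 ?exprn_gt0//; lra.
apply: (@le_trans _ _ (\int[mu]_(x in `[(- (r / 2))%R, (r / 2)%R]) (f x)%:E)%E); last first.
  apply: ge0_subset_integral => //.
    exact/measurable_EFinP.
  by move=> x _; rewrite lee_fin.
apply: ge0_le_integral => //.
- by move=> x _; rewrite lee_fin exprn_ge0// ltW.
- exact/measurable_EFinP/measurable_funTS.
move=> x /=; rewrite in_itv/= => /andP[x1 x2]; rewrite lee_fin /f fctE.
have h y : r / 2 <= y -> c <= flat 0 y.
  move=> ry; rewrite /flat ifT; last by lra.
  rewrite expr0 mul1r /c ler_expR lerN2 lef_pV2 ?posrE//; lra.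
by rewrite expr2 ler_pM ?(ltW c0)//; apply: h; lra.
Qed.

(* The weighted sum of derivatives is the kernel of averaged Taylor expansion
   at 0: its moments telescope to [(1 - 1) ^+ k]. *)
Lemma exists_moment_kernel (r : R) (N : nat) : 0 < r -> exists eta : nat -> R -> R,
  [/\ forall b, smooth1 (eta b),
      forall b (x : R), is_derive x 1 (eta b) (eta b.+1 x),
      forall b, supported r (eta b) &
      forall k b, (k <= N)%N -> (b <= N)%N ->
        moment k (eta b) = (-1) ^+ b * (k == b)%:R].
Proof.
move=> r0; have [B [sB rB B0]] := exists_bump r0.
pose F (j : 'I_N.+1) := derive1n j (monom j * (cst (int1 B)^-1 * B)).
have sG (j : nat) : smooth1 (monom j * (cst (int1 B)^-1 * B)).
  by apply: smooth1M; [exact: smooth1_monom|apply: smooth1M => //; exact: smooth1_cst].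
have rG (j : nat) : supported r (monom j * (cst (int1 B)^-1 * B)).
  by do 2! apply: supportedMl.
have sF j : smooth1 (F j) by exact: smooth1_derive1n.
have rF j : supported r (F j) by exact: supported_derive1n.
have [s0 rs0 _] := moment_sum 0 sF rF.
have m0 k : (k <= N)%N -> moment k (\sum_i F i) = (k == 0)%:R.
  move=> kN; have [_ _ ->] := moment_sum k sF rF.
  (* The i derivatives move onto [monom k] and leave [monom (k - i) * monom i], which is 'C(k, i)
     times [monom k]. The last factor does not depend on i, so only an alternating sum of binomial
     coefficients remains. *)
  have FE (i : 'I_N.+1) : moment k (F i) =
      (-1) ^+ i * 'C(k, i)%:R * (int1 (monom k * B) / int1 B).
    rewrite (@moment_derive1n r)//; case: ifPn => ik; last first.
      by rewrite bin_small ?mulr0 ?mul0r// ltnNge.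
    rewrite -mulrA; congr (_ * _).
    rewrite /moment [_ / _]mulrC mulrCA -!(@int1Z r); first last.
    - exact: supportedMl.
    - by apply: smooth1M => //; exact: smooth1_monom.
    - by do 2! apply: supportedMl.
    - by apply: smooth1M; [exact: smooth1_cst|apply: smooth1M => //; exact: smooth1_monom].
    congr int1; apply/funext => x; rewrite !fctE /monom.
    rewrite -(bin_fact ik) !natrM -[in x ^+ k](subnK ik) exprD; field.
    by rewrite B0 !pnatr_eq0 -!lt0n !fact_gt0 bin_gt0 ik.
  under eq_bigr do rewrite FE.
  rewrite -mulr_suml -(big_mkord predT (fun i => (-1) ^+ i * 'C(k, i)%:R)).
  rewrite (big_cat_nat (leq0n k.+1))//= [X in _ + X]big_nat_cond [X in _ + X]big1 ?addr0; last first.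
    by move=> i /andP[/andP[ki _] _]; rewrite bin_small ?mulr0.
  have := exprBn (1 : R) 1 k; rewrite subrr big_mkord.
  under [X in _ = X -> _]eq_bigr do rewrite !expr1n !mulr1 -mulr_natr.
  move=> <-; rewrite expr0n; case: k {kN FE} => [|k]; last by rewrite mul0r.
  rewrite mul1r (_ : monom 0 * B = B) ?divff//.
  by apply/funext => x; rewrite !fctE /monom expr0 invr1 !mul1r.
exists (fun b => derive1n b (\sum_i F i)); split.
- by move=> b; exact: smooth1_derive1n.
- by move=> b x; have [_] := smooth1_derive1 (smooth1_derive1n b s0).
- by move=> b; exact: supported_derive1n.
- move=> k b kN bN; rewrite (@moment_derive1n r)//; case: leqP => bk.
    by rewrite m0 ?(leq_trans (leq_subr _ _))// subn_eq0 eqn_leq bk andbT.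
  by rewrite ltn_eqF// mulr0.
Qed.

End SmoothLine.

(** * Iterated integrals and linear changes of variables *)

Section Transport.
Context d1 d2 (T1 : measurableType d1) (T2 : measurableType d2) (R : realType).
Variables (m : {measure set T1 -> \bar R}) (phi : T1 -> T2) (psi : T2 -> T1).
Hypotheses (mphi : measurable_fun setT phi) (mpsi : measurable_fun setT psi).
Hypotheses (phiK : cancel phi psi) (sm : sigma_finite setT m).

(** A push-forward may lose sigma-finiteness. The measurable left inverse [psi] carries an
    exhausting sequence over to the target. *)
Definition transport := pushforward m phi.

Let transport0 : transport set0 = 0%E.
Proof. by rewrite /transport /pushforward preimage_set0 measure0. Qed.

Let transport_ge0 A : (0 <= transport A)%E.
Proof. exact: measure_ge0. Qed.

Let transport_sigma_additive : semi_sigma_additive transport.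
Proof.
exact: (@measure_semi_sigma_additive _ _ _
  (measure_function_pushforward__canonical__measure_function_Measure m mphi)).
Qed.

HB.instance Definition _ := isMeasure.Build _ _ _ transport
  transport0 transport_ge0 transport_sigma_additive.

Let transport_sigma_finite : sigma_finite setT transport.
Proof.
have [F TF Foo] := sm.
exists (fun i => psi @^-1` F i); first by rewrite -preimage_bigcup -TF preimage_setT.
move=> i; have [mF mFoo] := Foo i; split.
  by rewrite -[X in measurable X]setTI; exact: mpsi.
rewrite /transport /pushforward (_ : _ @^-1` _ = F i)//.
by apply/seteqP; split => x /=; rewrite phiK.
Qed.

HB.instance Definition _ := Measure_isSigmaFinite.Build _ _ _ transport
  transport_sigma_finite.

Lemma exists_transport : exists m' : {sigma_finite_measure set T2 -> \bar R},
  forall f, measurable_fun setT f -> (forall y, 0 <= f y)%E ->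
    (\int[m']_y f y = \int[m]_x f (phi x))%E.
Proof.
exists transport => f mf f0.
by rewrite -[RHS](@ge0_integral_pushforward _ _ _ _ _ _ mphi m setT).
Qed.

End Transport.

(** With monotone exhaustions the diagonal rectangles already cover the product: a point found at
    indices i and j lies in the rectangle of index [maxn i j]. *)
Lemma sigma_finite_product d1 d2 (T1 : measurableType d1) (T2 : measurableType d2)
    (R : realType) (m1 : {sigma_finite_measure set T1 -> \bar R})
    (m2 : {sigma_finite_measure set T2 -> \bar R}) : sigma_finite setT (m1 \x m2)%E.
Proof.
have /sigma_finiteP[F [TF ndF Foo]] := sigma_finiteT m1.
have /sigma_finiteP[G [TG ndG Goo]] := sigma_finiteT m2.
exists (fun i => F i `*` G i) => [|i].
  apply/seteqP; split => // -[x y] _.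
  have [i _ Fx] : (\bigcup_i F i) x by rewrite -TF.
  have [j _ Gy] : (\bigcup_i G i) y by rewrite -TG.
  exists (maxn i j) => //; split => /=.
    by apply: (subsetPset _ _ (ndF _ _ (leq_maxl i j))).
  by apply: (subsetPset _ _ (ndG _ _ (leq_maxr i j))).
have [[mF Fi] [mG Gi]] := (Foo i, Goo i); split; first exact: measurableX.
by rewrite product_measure1E// lte_mul_pinfty// ge0_fin_numE.
Qed.

Section IteratedIntegral.
Variable R : realType.
Local Notation lam := (@lebesgue_measure R).
Local Notation borel := (measurableTypeR R).

Lemma measurable_cons_tuple n :
  measurable_fun setT (fun xt : borel * n.-tuple borel => (cons_tuple xt.1 xt.2 : n.+1.-tuple borel)).
Proof.
apply: (@measurable_cons _ _ _ _ fst n snd); [exact: measurable_fst|exact: measurable_snd].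
Qed.

Lemma measurable_uncons_tuple n :
  measurable_fun setT (fun t : n.+1.-tuple borel => (thead t, behead_tuple t : n.-tuple borel)).
Proof.
apply/measurable_fun_pair; first exact: measurable_tnth.
exact: measurable_behead.
Qed.

(** Realizing the recursive functional [iint] by one sigma-finite measure gives access to linearity,
    domination and Tonelli. The induction pushes the product measure forward along [cons_tuple],
    starting from a Dirac mass at the empty tuple. *)
Lemma exists_iint_measure n :
  exists m : {sigma_finite_measure set (n.-tuple borel) -> \bar R},
  forall f : n.-tuple R -> \bar R, measurable_fun (setT : set (n.-tuple borel)) f ->
  (forall t, 0 <= f t)%E -> iint f = (\int[m]_t f t)%E.
Proof.
elim: n => [|n [m mE]].
  exists (dirac ([tuple] : 0.-tuple borel)) => f mf f0.
  by rewrite integral_dirac// diracT mul1e.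
have phiK : cancel (fun xt : borel * n.-tuple borel => (cons_tuple xt.1 xt.2 : n.+1.-tuple borel))
  (fun t : n.+1.-tuple borel => (thead t, behead_tuple t : n.-tuple borel)).
  by move=> [x t]; congr pair; apply/val_inj.
have [m' m'E] := exists_transport (@measurable_cons_tuple n)
  (@measurable_uncons_tuple n) phiK (sigma_finite_product lam m).
exists m' => f mf f0.
have mfc := measurableT_comp mf (@measurable_cons_tuple n).
rewrite m'E//.
rewrite fubini_tonelli1//=; apply: eq_integral => x _.
rewrite mE//; exact: measurableT_comp mfc (pair1_measurable x).
Qed.

(* [iint] agrees with this measure on nonnegative measurable functions only; for
   signed functions it may differ from the integral. *)
Definition tmeas n : {sigma_finite_measure set (n.-tuple borel) -> \bar R} :=
  sval (cid (exists_iint_measure n)).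

Lemma iintE n (f : n.-tuple R -> \bar R) : measurable_fun (setT : set (n.-tuple borel)) f ->
  (forall t, 0 <= f t)%E -> iint f = (\int[tmeas n]_t f t)%E.
Proof. exact: svalP (cid (exists_iint_measure n)) f. Qed.

Lemma measurable_cons_pair n (f : n.+1.-tuple R -> \bar R) :
  measurable_fun (setT : set (n.+1.-tuple borel)) f ->
  measurable_fun (setT : set (borel * n.-tuple borel)) (fun xt => f (cons_tuple xt.1 xt.2)).
Proof. by move=> mf; exact: measurableT_comp mf (@measurable_cons_tuple n). Qed.

Lemma measurable_cons2 n (f : n.+1.-tuple R -> \bar R) x :
  measurable_fun (setT : set (n.+1.-tuple borel)) f ->
  measurable_fun (setT : set (n.-tuple borel)) (fun t => f (cons_tuple x t)).
Proof.
by move=> /measurable_cons_pair mf; exact: measurableT_comp mf (pair1_measurable x).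
Qed.

Lemma measurable_cons1 n (f : n.+1.-tuple R -> \bar R) t :
  measurable_fun (setT : set (n.+1.-tuple borel)) f ->
  measurable_fun (setT : set borel) (fun x => f (cons_tuple x t)).
Proof.
by move=> /measurable_cons_pair mf; exact: measurableT_comp mf (pair2_measurable t).
Qed.

Lemma iint_swap n (f : n.+1.-tuple R -> \bar R) :
  measurable_fun (setT : set (n.+1.-tuple borel)) f -> (forall t, 0 <= f t)%E ->
  iint f = iint (fun t => \int[lam]_x f (cons_tuple x t))%E.
Proof.
move=> mf f0 /=; rewrite iintE//.
- have := fubini_tonelli (m1 := lam) (m2 := tmeas n) (fun xt => f (cons_tuple xt.1 xt.2)).
  move=> /(_ (measurable_cons_pair mf)) <-//.
  by apply: eq_integral => x _; rewrite iintE//; exact: measurable_cons2.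
- exact: (measurable_fun_fubini_tonelli_G (m1 := lam) (fun xt => f (cons_tuple xt.1 xt.2)) (measurable_cons_pair mf)).
- by move=> t; exact: integral_ge0.
Qed.

Lemma tmeasS n (f : n.+1.-tuple R -> \bar R) :
  measurable_fun (setT : set (n.+1.-tuple borel)) f -> (forall t, 0 <= f t)%E ->
  (\int[tmeas n.+1]_t f t = \int[lam]_x \int[tmeas n]_t f (cons_tuple x t))%E.
Proof.
move=> mf f0; rewrite -iintE//=; apply: eq_integral => x _.
by rewrite iintE//; exact: measurable_cons2.
Qed.

Lemma eq_iint n (f g : n.-tuple R -> \bar R) : f =1 g -> iint f = iint g.
Proof. by move=> /funext ->. Qed.

Lemma iint_ge0 n (f : n.-tuple R -> \bar R) : (forall t, 0 <= f t)%E -> (0 <= iint f)%E.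
Proof.
elim: n f => //= n IH f f0; apply: integral_ge0 => x _; exact: IH.
Qed.

(** By uniqueness of Lebesgue measure it suffices to compare both measures on intervals ]u, v]. For
    c < 0 the preimage is closed on the left instead, hence the two cases. *)
Lemma integral_affine (c b : R) (f : R -> \bar R) : c != 0 ->
  measurable_fun (setT : set borel) f -> (forall x, 0 <= f x)%E ->
  (\int[lam]_x f x = `|c|%:E * \int[lam]_x f (c * x + b)%R)%E.
Proof.
move=> c0 mf f0; pose phi (x : borel) : borel := c * x + b.
have mphi : measurable_fun setT phi.
  by apply: measurable_funD; [apply: measurable_funM|]; [exact: measurable_cst|exact: measurable_id|exact: measurable_cst].
have nc0 : 0 <= `|c| by [].
pose pf := measure_function_pushforward__canonical__measure_function_Measure lam mphi.
pose nu := mscale (NngNum nc0) pf.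
have -> : (\int[lam]_x f x = \int[nu]_x f x)%E.
  apply: eq_measure_integral => A mA _; apply: lebesgue_measure_unique => // X [[u v] _ <-].
  rewrite /nu/= /mscale/= /pushforward.
  have [cp|cn] := ltP 0 c.
  - have -> : phi @^-1` [set` `]u, v]] = [set` `](u - b) / c, (v - b) / c]].
      apply/seteqP; split => x /=; rewrite !in_itv/= /phi ltr_pdivrMr// ler_pdivlMr//;
      by move=> /andP[? ?]; apply/andP; split; lra.
    rewrite !lebesgue_measure_itv/= !lte_fin ltr_pdivrMr// divfK ?gt_eqF// ltrD2r.
    case: ifP => uv; last by rewrite mule0.
    by rewrite (gtr0_norm cp) -!EFinD -EFinM; congr EFin; field; rewrite gt_eqF.
  - have {}cn : c < 0 by rewrite lt_neqAle c0.
    have -> : phi @^-1` [set` `]u, v]] = [set` `[(v - b) / c, (u - b) / c[].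
      apply/seteqP; split => x /=; rewrite !in_itv/= /phi ltr_ndivlMr// ler_ndivrMr//;
      by move=> /andP[? ?]; apply/andP; split; lra.
    rewrite !lebesgue_measure_itv/= !lte_fin ltr_ndivlMr// divfK// ltrD2r.
    case: ifP => uv; last by rewrite mule0.
    by rewrite (ltr0_norm cn) -!EFinD -EFinM; congr EFin; field.
rewrite ge0_integral_mscale//.
by rewrite /= (@ge0_integral_pushforward _ _ _ _ _ _ mphi lam setT).
Qed.


(** * Functions of row vectors and their linear substitutions *)

Definition tuple_of_row n (x : 'rV[R]_n) : n.-tuple R := [tuple x 0 i | i < n].

Lemma tuple_of_rowK n : cancel (@tuple_of_row n) (@row_of_tuple R n).
Proof. by move=> x; apply/rowP => i; rewrite mxE tnth_mktuple. Qed.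

Definition rint n (F : 'rV[R]_n -> \bar R) := iint (F \o @row_of_tuple R n).

Definition mrow n d (T : measurableType d) (F : 'rV[R]_n -> T) :=
  measurable_fun (setT : set (n.-tuple borel)) (F \o @row_of_tuple R n).

Lemma mrow_coord n (i : 'I_n) : @mrow n _ borel (fun x => x 0 i).
Proof.
rewrite /mrow (_ : _ \o _ = fun t : n.-tuple borel => tnth t i); first exact: measurable_tnth.
by apply/funext => t; rewrite /= mxE.
Qed.

Lemma mrow_affine_coord n p (M : 'M[R]_(n, p)) (b : 'rV[R]_p) i :
  @mrow n _ borel (fun x => (x *m M + b) 0 i).
Proof.
rewrite /mrow (_ : _ \o _ = fun t : n.-tuple borel => \sum_j tnth t j * M j i + b 0 i); last first.
  by apply/funext => t; rewrite /= !mxE; congr (_ + _); apply: eq_bigr => j _; rewrite mxE.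
apply: measurable_funD; last exact: measurable_cst.
apply: measurable_sum => j; apply: measurable_funM; last exact: measurable_cst.
exact: measurable_tnth.
Qed.

Lemma mrow_affine n p d (T : measurableType d) (M : 'M[R]_(n, p)) b (F : 'rV[R]_p -> T) :
  mrow F -> mrow (fun x => F (x *m M + b)).
Proof.
rewrite /mrow => mF.
have mt : measurable_fun (setT : set (n.-tuple borel))
    (fun t => tuple_of_row (row_of_tuple t *m M + b) : p.-tuple borel).
  apply/measurable_fun_tnthP => i.
  rewrite (_ : _ \o _ = (fun x => (x *m M + b) 0 i) \o @row_of_tuple R n); first exact: mrow_affine_coord.
  by apply/funext => t; rewrite /= tnth_mktuple.
rewrite (_ : _ \o _ = (F \o @row_of_tuple R p) \o (fun t => tuple_of_row (row_of_tuple t *m M + b))); first exact: measurableT_comp mF mt.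
by apply/funext => t /=; rewrite tuple_of_rowK.
Qed.

Lemma mrow_mul n p d (T : measurableType d) (M : 'M[R]_(n, p)) (F : 'rV[R]_p -> T) :
  mrow F -> mrow (fun x => F (x *m M)).
Proof. by move/(@mrow_affine n p _ _ M 0); congr mrow; apply/funext => x; rewrite addr0. Qed.

Lemma mrow_add n d (T : measurableType d) b (F : 'rV[R]_n -> T) :
  mrow F -> mrow (fun x => F (x + b)).
Proof. by move/(@mrow_affine n n _ _ 1%:M b); congr mrow; apply/funext => x; rewrite mulmx1. Qed.

Lemma row_of_cons n x (t : n.-tuple R) :
  row_of_tuple (cons_tuple x t) = row_mx (x%:M : 'M[R]_1) (row_of_tuple t) :> 'rV_(1 + n).
Proof.
apply/rowP => i; rewrite !mxE; case: splitP => j ij; rewrite !mxE.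
  by rewrite !ord1 (_ : i = ord0)//; apply/val_inj; rewrite /= ij ord1.
by rewrite (_ : i = lift ord0 j) ?tnthS//; apply/val_inj.
Qed.

Lemma rintS n (F : 'rV[R]_(1 + n) -> \bar R) :
  rint (F : 'rV_n.+1 -> \bar R) = (\int[lam]_x rint (fun t => F (row_mx x%:M t)))%E.
Proof.
rewrite /rint/=; apply: eq_integral => x _; apply: eq_iint => t /=.
by rewrite row_of_cons.
Qed.

Lemma mrow_rowmx n (F : 'rV[R]_(1 + n) -> \bar R) x :
  mrow (F : 'rV_n.+1 -> \bar R) -> mrow (fun t : 'rV_n => F (row_mx x%:M t)).
Proof.
move/(measurable_cons2 x); apply: eq_measurable_fun => t _.
by rewrite /= row_of_cons.
Qed.

Lemma measurable_rint n (F : 'rV[R]_(1 + n) -> \bar R) :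
  mrow (F : 'rV_n.+1 -> \bar R) -> (forall x, 0 <= F x)%E ->
  measurable_fun (setT : set borel) (fun x => rint (fun t => F (row_mx x%:M t))).
Proof.
move=> mF F0.
have := measurable_fun_fubini_tonelli_F (m2 := tmeas n) _ (measurable_cons_pair mF) (fun=> F0 _).
apply: eq_measurable_fun => x _; rewrite /fubini_F /rint iintE.
- by apply: eq_integral => t _ /=; rewrite row_of_cons.
- exact: mrow_rowmx mF.
- by move=> t; exact: F0.
Qed.

Lemma rint_swap n (F : 'rV[R]_(1 + n) -> \bar R) :
  mrow (F : 'rV_n.+1 -> \bar R) -> (forall x, 0 <= F x)%E ->
  rint (F : 'rV_n.+1 -> \bar R) = rint (fun t => \int[lam]_x F (row_mx x%:M t))%E.
Proof.
move=> mF F0; rewrite /rint iint_swap//; last by move=> t; exact: F0.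
apply: eq_iint => t /=; apply: eq_integral => x _; by rewrite row_of_cons.
Qed.

Lemma measurable_rowmx1 n (F : 'rV[R]_(1 + n) -> \bar R) t :
  mrow (F : 'rV_n.+1 -> \bar R) ->
  measurable_fun (setT : set borel) (fun x => F (row_mx x%:M t)).
Proof.
move/(measurable_cons1 (tuple_of_row t)); apply: eq_measurable_fun => x _.
by rewrite /= row_of_cons tuple_of_rowK.
Qed.

Lemma integral_shift (b : R) (f : R -> \bar R) :
  measurable_fun (setT : set borel) f -> (forall x, 0 <= f x)%E ->
  (\int[lam]_x f x = \int[lam]_x f (x + b)%R)%E.
Proof.
move=> mf f0; rewrite (@integral_affine 1 b)// ?oner_neq0// normr1 mul1e.
by under eq_integral do rewrite mul1r.
Qed.

Lemma rint_shift n (b : 'rV[R]_n) (F : 'rV[R]_n -> \bar R) :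
  mrow F -> (forall x, 0 <= F x)%E -> rint F = rint (fun x => F (x + b)).
Proof.
elim: n b F => [|n IH] b F mF F0.
  by apply: eq_iint => t /=; congr F; apply/rowP => -[].
rewrite (rintS (F : 'rV_(1 + n) -> _)) (@integral_shift ((b : 'rV[R]_(1 + n)) 0 0)); first last.
- by move=> x; apply: iint_ge0 => t; exact: F0.
- exact: measurable_rint.
rewrite rintS; apply: eq_integral => x _.
rewrite (IH (rsubmx (b : 'rV[R]_(1 + n))) _ (mrow_rowmx _ mF)); last by move=> t; exact: F0.
apply: eq_iint => t /=; congr F.
set b' : 'rV[R]_(1 + n) := b.
rewrite -[X in _ = _ + X]/(b' : 'rV[R]_n.+1) -[X in _ = _ + X](hsubmxK b').
apply: (@etrans _ _ _ _ _ (esym (@add_row_mx _ 1 1 n x%:M (row_of_tuple t) (lsubmx b') (rsubmx b')))).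
rewrite ?hsubmxK; congr row_mx.
rewrite raddfD/=; congr (_ + _); rewrite [RHS]mx11_scalar mxE; congr (_ %:M); congr (b _ _).
exact/val_inj.
Qed.

(* The constant is |det M|, but its value is never needed. *)
Definition scales n (M : 'M[R]_n) := exists2 c : R, 0 < c &
  forall F : 'rV[R]_n -> \bar R, mrow F -> (forall x, 0 <= F x)%E ->
    rint F = (c%:E * rint (fun x => F (x *m M)))%E.

Lemma scalesM n (M N : 'M[R]_n) : scales M -> scales N -> scales (M *m N).
Proof.
move=> [c c0 cM] [e e0 eN]; exists (e * c) => [|F mF F0]; first exact: mulr_gt0.
rewrite eN// cM//; first by rewrite EFinM muleA; congr (_ * _)%E; apply: eq_iint => t /=; rewrite mulmxA.
exact: mrow_mul.
Qed.

Lemma scales_diag n a (M : 'M[R]_n) : a != 0 -> scales M ->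
  scales (block_mx (a%:M : 'M[R]_1) 0 0 M : 'M[R]_n.+1).
Proof.
move=> a0 [c c0 cM]; exists (c * `|a|) => [|F mF F0]; first by rewrite mulr_gt0 ?normr_gt0.
pose D := block_mx (a%:M : 'M[R]_1) 0 0 M; pose F' (x : 'rV[R]_(1 + n)) := F (x *m D).
have DE x (t : 'rV_n) : row_mx x%:M t *m D = row_mx (a * x)%:M (t *m M).
  by rewrite mul_row_block !mulmx0 addr0 add0r -scalar_mxM mulrC.
rewrite (rintS (F : 'rV[R]_(1 + n) -> _)) (@integral_affine a 0)//; first last.
- by move=> x; apply: iint_ge0 => t; exact: F0.
- exact: measurable_rint.
rewrite EFinM [(c%:E * _)%E]muleC -muleA; congr (_ * _)%E.
rewrite (rintS F') -ge0_integralZl//; first last.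
- exact: ltW.
- by move=> x _; apply: iint_ge0 => t; exact: F0.
- by apply: measurable_rint => [|x]; [exact: mrow_mul|exact: F0].
apply: eq_integral => x _; rewrite addr0 cM//; last exact: mrow_rowmx.
by congr (_ * _)%E; apply: eq_iint => t; rewrite /F'/= DE.
Qed.

(** This shear adds x w to the remaining coordinates. For a fixed first coordinate x it is a
    translation of the inner integral. *)
Lemma scales_upper n (w : 'rV[R]_n) : scales (block_mx (1%:M : 'M[R]_1) w 0 1%:M : 'M[R]_n.+1).
Proof.
exists 1 => // F mF F0; rewrite mul1e !(rintS (_ : 'rV_(1 + n) -> _)).
apply: eq_integral => x _; rewrite (rint_shift (x *: w) (mrow_rowmx _ mF)); last by move=> t; exact: F0.
apply: eq_iint => t /=; congr F.
transitivity (row_mx x%:M (row_of_tuple t) *m block_mx (1%:M : 'M[R]_1) w 0 1%:M : 'rV[R]_(1 + n)) => //.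
by rewrite mul_row_block !mulmx1 mulmx0 addr0 mul_scalar_mx addrC.
Qed.

(** Here the first coordinate is moved by an amount depending on the others, so Tonelli first makes
    it the innermost variable, where the shear is again a translation. *)
Lemma scales_lower n (u : 'cV[R]_n) : scales (block_mx (1%:M : 'M[R]_1) 0 u 1%:M : 'M[R]_n.+1).
Proof.
exists 1 => // F mF F0; rewrite mul1e !(rint_swap (F := (_ : 'rV_(1 + n) -> _)))//; last exact: mrow_mul.
apply: eq_iint => t /=; rewrite (@integral_shift ((row_of_tuple t *m u) 0 0))//; last exact: measurable_rowmx1.
apply: eq_integral => x _; congr F.
transitivity (row_mx x%:M (row_of_tuple t) *m block_mx (1%:M : 'M[R]_1) 0 u 1%:M : 'rV[R]_(1 + n)) => //.
by rewrite mul_row_block !mulmx1 mulmx0 add0r raddfD/= -mx11_scalar.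
Qed.

(** Block elimination: M is a lower shear times a block diagonal matrix times an upper shear, the
    lower diagonal block being the Schur complement S of the pivot. *)
Lemma scales_pivot n (M : 'M[R]_(1 + n)) :
  (forall N : 'M[R]_n, N \in unitmx -> scales N) ->
  M \in unitmx -> M 0 0 != 0 -> scales (M : 'M[R]_n.+1).
Proof.
move=> IH Mu a0; set a := M 0 0 in a0.
have aE : ulsubmx M = a%:M.
  by rewrite [LHS]mx11_scalar /a !mxE; congr (M _ _)%:M; apply/val_inj.
set w := ursubmx M; set u := dlsubmx M; pose S := drsubmx M - a^-1 *: (u *m w).
have ME : M = block_mx 1%:M 0 (a^-1 *: u) 1%:M *m block_mx a%:M 0 0 S *m block_mx 1%:M (a^-1 *: w) 0 1%:M.
  rewrite -[LHS]submxK aE !mulmx_block !(mulmx0, mul0mx, mulmx1, mul1mx, addr0, add0r).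
  rewrite mul_scalar_mx scalerA divff// scale1r mul_mx_scalar scalerA divff// scale1r.
  by congr block_mx; rewrite -scalemxAr addrC subrK.
have Su : S \in unitmx.
  move: Mu; rewrite ME !unitmx_mul => /andP[/andP[_ +] _].
  by rewrite !unitmxE det_ublock unitrM => /andP[].
rewrite ME; apply: scalesM; last exact: scales_upper.
by apply: scalesM; [exact: scales_lower|apply: scales_diag => //; exact: IH].
Qed.

Lemma unitmx_scales n (M : 'M[R]_n) : M \in unitmx -> scales M.
Proof.
elim: n M => [|n IH] M Mu.
  exists 1 => // F mF F0; rewrite mul1e.
  by apply: eq_iint => t /=; congr F; apply/rowP => -[].
have [a0|a0] := eqVneq (M 0 0) 0; last exact: scales_pivot.
(* A vanishing pivot is made nonzero by adding another row to the first one. *)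
pose M1 : 'M[R]_(1 + n) := M.
have ul0 : ulsubmx M1 = 0.
  by apply/matrixP => i j; rewrite !mxE !ord1 -a0; congr (M _ _); exact/val_inj.
have [i ui] : exists i, dlsubmx M1 i 0 != 0.
  apply/existsP; apply: contraT => /existsPn dl0.
  have Mu1 : M1 \in unitmx by [].
  move: Mu1; rewrite unitmxE -[M1]submxK ul0 (_ : dlsubmx M1 = 0).
    by rewrite det_ublock det0 mul0r unitr0.
  by apply/matrixP => k j; rewrite [RHS]mxE ord1; apply/eqP; have := dl0 k; rewrite negbK.
pose N (s : R) : 'M[R]_(1 + n) := block_mx 1%:M (s *: delta_mx 0 i) 0 1%:M.
have NN : N (-1) *m N 1 = 1%:M.
  rewrite mulmx_block !(mulmx0, mul0mx, mulmx1, mul1mx, addr0, add0r) scaleN1r scale1r subrr.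
  by rewrite -scalar_mx_block.
have -> : M = N (-1) *m (N 1 *m M1) by rewrite mulmxA NN mul1mx.
apply: scalesM; first exact: scales_upper.
apply: scales_pivot => //.
  by rewrite unitmx_mul Mu andbT; have /mulmx1_unit[] := NN.
have -> : (N 1 *m M1) 0 0 = ulsubmx (N 1 *m M1) 0 0.
  by rewrite /ulsubmx /usubmx /lsubmx [RHS]mxE [RHS]mxE; congr fun_of_matrix; exact/val_inj.
rewrite -[M1]submxK mulmx_block ul0 mulmx0 add0r scale1r block_mxKul.
by rewrite -rowE mxE.
Qed.

End IteratedIntegral.

(** * Integrals of signed functions of a row vector *)

Section SignedIntegral.
Variable R : realType.
Local Notation lam := (@lebesgue_measure R).
Local Notation borel := (measurableTypeR R).

(* Signed functions are reduced to nonnegative ones through f = (|f| + f) - |f|. *)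
Lemma integrable_nonneg_split d (T : measurableType d) (mu : {measure set T -> \bar R}) (f : T -> R) :
  mu.-integrable setT (EFin \o f) ->
  mu.-integrable setT (EFin \o (fun x => `|f x| + f x)) /\
  mu.-integrable setT (EFin \o (fun x => `|f x|)).
Proof.
move=> fi.
have fn : mu.-integrable setT (EFin \o (fun x => `|f x|)) by exact: integrable_norm.
by split => //; exact: (integrableD measurableT fn fi).
Qed.

Lemma Rintegral_nonneg_split d (T : measurableType d) (mu : {measure set T -> \bar R}) (f : T -> R) :
  mu.-integrable setT (EFin \o f) ->
  \int[mu]_x f x = \int[mu]_x (`|f x| + f x) - \int[mu]_x `|f x|.
Proof.
move=> fi; have [f1 f2] := integrable_nonneg_split fi.
rewrite -RintegralB//; apply: eq_Rintegral => x _; lra.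
Qed.

Lemma RintegralEFin d (T : measurableType d) (mu : {measure set T -> \bar R}) (f : T -> R) :
  mu.-integrable setT (EFin \o f) -> (\int[mu]_x (f x)%:E = (\int[mu]_x f x)%:E)%E.
Proof. by move=> fi; rewrite /Rintegral fineK//; exact: integrable_fin_num fi. Qed.

Definition tensor n (a : R -> R) (b : n.-tuple R -> R) (t : n.+1.-tuple R) : R :=
  a (thead t) * b (behead_tuple t).

Lemma measurable_tensor n (a : borel -> borel) (b : n.-tuple borel -> borel) :
  measurable_fun setT a -> measurable_fun setT b ->
  measurable_fun (setT : set (n.+1.-tuple borel)) (tensor a b : _ -> borel).
Proof.
move=> ma mb; apply: measurable_funM.
  exact: measurableT_comp ma (measurable_tnth _).
exact: measurableT_comp mb (@measurable_behead _ _ n).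
Qed.

Lemma ge0_integral_tensor n (a : R -> R) (b : n.-tuple R -> R) :
  (forall x, 0 <= a x) -> (forall t, 0 <= b t) ->
  lam.-integrable setT (EFin \o a) -> (tmeas R n).-integrable setT (EFin \o b) ->
  (tmeas R n.+1).-integrable setT (EFin \o tensor a b) /\
  \int[tmeas R n.+1]_t tensor a b t = (\int[lam]_x a x) * (\int[tmeas R n]_t b t).
Proof.
move=> a0 b0 ia ib.
have ma : measurable_fun (setT : set borel) (a : _ -> borel) by have [/measurable_EFinP] := integrableP _ _ _ ia.
have mb : measurable_fun (setT : set (n.-tuple borel)) (b : _ -> borel) by have [/measurable_EFinP] := integrableP _ _ _ ib.
have mt := measurable_tensor ma mb.
have t0 t : 0 <= tensor a b t by rewrite mulr_ge0.
have e : (\int[tmeas R n.+1]_t (tensor a b t)%:E =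
    ((\int[lam]_x a x) * (\int[tmeas R n]_t b t))%:E)%E.
  rewrite tmeasS//; last exact/measurable_EFinP.
  rewrite EFinM -!RintegralEFin// -ge0_integralZr//; first last.
  - by apply: integral_ge0 => t _; rewrite lee_fin.
  - by move=> x _; rewrite lee_fin.
  - exact/measurable_EFinP.
  apply: eq_integral => x _; rewrite -ge0_integralZl//; first last.
  - by rewrite lee_fin.
  - by move=> t _; rewrite lee_fin.
  - exact/measurable_EFinP.
  apply: eq_integral => t _; rewrite /tensor -EFinM; congr (a _ * b _)%:E.
  exact/val_inj.
split; last by rewrite /Rintegral e.
apply/integrableP; split; first exact/measurable_EFinP.
under eq_integral do rewrite /= ger0_norm//.
by rewrite e ltry.
Qed.

(** Both factors are written as (|f| + f) - |f|, which makes the product a signed sum of four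
    nonnegative tensors, to each of which Tonelli applies. *)
Lemma integral_tensor n (a : R -> R) (b : n.-tuple R -> R) :
  lam.-integrable setT (EFin \o a) -> (tmeas R n).-integrable setT (EFin \o b) ->
  (tmeas R n.+1).-integrable setT (EFin \o tensor a b) /\
  \int[tmeas R n.+1]_t tensor a b t = (\int[lam]_x a x) * (\int[tmeas R n]_t b t).
Proof.
move=> ia ib.
have [a1 a2] := integrable_nonneg_split ia.
have [b1 b2] := integrable_nonneg_split ib.
have n0 (y : R) : 0 <= `|y| + y by have := ler_norm (- y); rewrite normrN; lra.
have [i11 e11] := ge0_integral_tensor (fun=> n0 _) (fun=> n0 _) a1 b1.
have [i12 e12] := ge0_integral_tensor (fun=> n0 _) (fun=> normr_ge0 _) a1 b2.
have [i21 e21] := ge0_integral_tensor (fun=> normr_ge0 _) (fun=> n0 _) a2 b1.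
have [i22 e22] := ge0_integral_tensor (fun=> normr_ge0 _) (fun=> normr_ge0 _) a2 b2.
have j1 := integrableB measurableT i11 i12.
have j2 := integrableB measurableT i21 i22.
have e t : tensor a b t = (tensor (fun x => `|a x| + a x) (fun t => `|b t| + b t) t
   - tensor (fun x => `|a x| + a x) (fun t => `|b t|) t)
   - (tensor (fun x => `|a x|) (fun t => `|b t| + b t) t
   - tensor (fun x => `|a x|) (fun t => `|b t|) t) by rewrite /tensor; ring.
split.
  apply: eq_integrable (integrableB measurableT j1 j2) => // t _.
  by rewrite /= e.
under eq_Rintegral do rewrite e.
rewrite RintegralB// RintegralB// RintegralB// e11 e12 e21 e22.
by rewrite (Rintegral_nonneg_split ia) (Rintegral_nonneg_split ib); ring.
Qed.

Lemma integral_prod n (f : 'I_n -> R -> R) :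
  (forall i, lam.-integrable setT (EFin \o f i)) ->
  (tmeas R n).-integrable setT (EFin \o (fun t => \prod_i f i (tnth t i))) /\
  \int[tmeas R n]_t (\prod_i f i (tnth t i)) = \prod_i (\int[lam]_x f i x).
Proof.
elim: n f => [|n IH] f fi.
  have e : (\int[tmeas R 0]_t (\prod_i f i (tnth t i))%:E = 1)%E.
    rewrite -iintE//=; first by rewrite big_ord0.
    - by under eq_fun do rewrite big_ord0; exact: measurable_cst.
    - by move=> t; rewrite big_ord0.
  split; last by rewrite /Rintegral e big_ord0.
  apply/integrableP; split.
    by apply/measurable_EFinP; under eq_fun do rewrite big_ord0; exact: measurable_cst.
  under eq_integral do rewrite /= ger0_norm ?big_ord0//.
  rewrite (_ : (\int[_]_t _)%E = 1%:E) ?ltry// -[RHS]e.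
  by apply: eq_integral => t _; rewrite big_ord0.
have [i1 e1] := IH (fun i => f (lift ord0 i)) (fun i => fi _).
have [i2 e2] := integral_tensor (fi ord0) i1.
have e t : \prod_i f i (tnth t i) = tensor (f ord0) (fun t => \prod_i f (lift ord0 i) (tnth t i)) t.
  rewrite big_ord_recl /tensor; congr (_ * _); apply: eq_bigr => i _.
  by rewrite [in LHS](tuple_eta t) tnthS.
split.
  by apply: eq_integrable i2 => // t _; rewrite /= e.
under eq_Rintegral do rewrite e.
by rewrite e2 e1 big_ord_recl.
Qed.

Definition rintegrable n (F : 'rV[R]_n -> R) :=
  (tmeas R n).-integrable setT (EFin \o (F \o @row_of_tuple R n)).

Definition RI n (F : 'rV[R]_n -> R) : R := \int[tmeas R n]_t F (row_of_tuple t).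

Lemma rintegrable_mrow n (F : 'rV[R]_n -> R) : rintegrable F -> mrow (F : _ -> borel).
Proof. by case/integrableP => /measurable_EFinP. Qed.

Lemma rintegrableD n (F G : 'rV[R]_n -> R) : rintegrable F -> rintegrable G ->
  rintegrable (fun x => F x + G x).
Proof. by move=> iF iG; exact: (integrableD measurableT iF iG). Qed.

Lemma rintegrableZ n c (F : 'rV[R]_n -> R) : rintegrable F -> rintegrable (fun x => c * F x).
Proof. by move=> iF; exact: (integrableZl measurableT c iF). Qed.

Lemma RID n (F G : 'rV[R]_n -> R) : rintegrable F -> rintegrable G ->
  RI (fun x => F x + G x) = RI F + RI G.
Proof. by move=> iF iG; rewrite /RI RintegralD. Qed.

Lemma RIZ n c (F : 'rV[R]_n -> R) : rintegrable F -> RI (fun x => c * F x) = c * RI F.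
Proof. by move=> iF; rewrite /RI RintegralZl. Qed.

Lemma rintegrable_sum n I (s : seq I) (P : pred I) (F : I -> 'rV[R]_n -> R) :
  (forall i, rintegrable (F i)) ->
  rintegrable (fun x => \sum_(i <- s | P i) F i x) /\
  RI (fun x => \sum_(i <- s | P i) F i x) = \sum_(i <- s | P i) RI (F i).
Proof.
move=> iF; elim: s => [|i s [IH1 IH2]].
  rewrite big_nil; under eq_fun do rewrite big_nil.
  split; first exact: integrable0.
  by rewrite /RI Rintegral_cst// mul0r.
rewrite big_cons; under [X in rintegrable X]eq_fun do rewrite big_cons.
under [X in RI X]eq_fun do rewrite big_cons.
by case: ifP => _ //; split; [exact: rintegrableD|rewrite RID// IH2].
Qed.

Lemma RI_ge0 n (F : 'rV[R]_n -> R) : (forall x, 0 <= F x) -> 0 <= RI F.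
Proof. by move=> F0; apply: Rintegral_ge0 => t _; exact: F0. Qed.

Lemma le_RI n (F G : 'rV[R]_n -> R) : rintegrable F -> rintegrable G ->
  (forall x, F x <= G x) -> RI F <= RI G.
Proof. by move=> iF iG FG; apply: le_Rintegral => // t _; exact: FG. Qed.

Lemma rintegrable_le n (F G : 'rV[R]_n -> R) : mrow (F : _ -> borel) -> rintegrable G ->
  (forall x, `|F x| <= G x) -> rintegrable F.
Proof.
move=> mF iG FG; apply: le_integrable iG => //; first exact/measurable_EFinP.
by move=> t _ /=; rewrite lee_fin (le_trans (FG _))// ler_norm.
Qed.

Lemma rint_RI n (F : 'rV[R]_n -> R) : rintegrable F -> (forall x, 0 <= F x) ->
  rint (fun x => (F x)%:E) = (RI F)%:E.
Proof.
move=> iF F0; rewrite /rint iintE//.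
- by rewrite -[RHS]RintegralEFin.
- by apply/measurable_EFinP; exact: rintegrable_mrow.
- by move=> t; rewrite /= lee_fin.
Qed.

Lemma rint_integrable n (F : 'rV[R]_n -> R) : mrow (F : _ -> borel) ->
  (forall x, 0 <= F x) -> (rint (fun x => (F x)%:E) < +oo)%E -> rintegrable F.
Proof.
move=> mF F0; rewrite /rint iintE//; first last.
- by move=> t; rewrite /= lee_fin.
- exact/measurable_EFinP.
move=> h; apply/integrableP; split; first exact/measurable_EFinP.
by under eq_integral do rewrite /= ger0_norm//.
Qed.

(** A change of variables with constant Jacobian c, reduced to what the later estimates use. *)
Definition volume_scaling n (A : 'rV[R]_n -> 'rV[R]_n) (c : R) :=
  [/\ 0 < c, forall d (T : measurableType d) (F : 'rV[R]_n -> T), mrow F -> mrow (F \o A) &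
  forall F : 'rV[R]_n -> \bar R, mrow F -> (forall x, 0 <= F x)%E ->
    rint F = (c%:E * rint (F \o A))%E].

Lemma affine_volume_scaling n (M : 'M[R]_n) (b : 'rV[R]_n) : M \in unitmx ->
  exists c, volume_scaling (fun x => x *m M + b) c.
Proof.
move=> /unitmx_scales[c c0 cM]; exists c; split => // [d T F|F mF F0]; first exact: mrow_affine.
rewrite (rint_shift b mF F0) cM//; exact: mrow_add.
Qed.

Lemma RI_scaling n A c (F : 'rV[R]_n -> R) : volume_scaling A c -> mrow (F : _ -> borel) ->
  rintegrable (F \o A) -> rintegrable F /\ RI F = c * RI (F \o A).
Proof.
move=> [c0 mA cA] mF iFA.
have pos (G : 'rV[R]_n -> R) : mrow (G : _ -> borel) -> (forall x, 0 <= G x) ->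
    rintegrable (G \o A) -> rintegrable G /\ RI G = c * RI (G \o A).
  move=> mG G0 iGA.
  have e : rint (fun x => (G x)%:E) = (c * RI (G \o A))%:E.
    have mG' : mrow (fun x => (G x)%:E) by apply/measurable_EFinP.
    rewrite cA//.
    by rewrite EFinM -rint_RI// => x; exact: G0.
  have iG : rintegrable G by apply: rint_integrable => //; rewrite e ltry.
  by split => //; apply: EFin_inj; rewrite -rint_RI.
have [i1 i2] := integrable_nonneg_split iFA.
have mn : mrow ((fun x => `|F x|) : _ -> borel) by exact: measurableT_comp mF.
have n0 (y : R) : 0 <= `|y| + y by have := ler_norm (- y); rewrite normrN; lra.
have [j1 e1] := pos (fun x => `|F x| + F x) (measurable_funD mn mF) (fun=> n0 _) i1.
have [j2 e2] := pos (fun x => `|F x|) mn (fun=> normr_ge0 _) i2.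
have iF : rintegrable F by apply: rintegrable_le j2 _.
split=> //; rewrite /RI (Rintegral_nonneg_split iF) [in RHS](Rintegral_nonneg_split iFA).
by move: e1 e2; rewrite /RI => -> ->; rewrite mulrBr.
Qed.

End SignedIntegral.

(** * Multi-indices and polynomials *)

Section MultiIndex.
Context {d l : nat}.

Definition mindex := {ffun 'I_d -> 'I_l.+1}.

Definition wt (b : 'I_d -> nat) : nat := (\sum_i b i)%N.
Local Notation mwt b := (wt (fun i => nat_of_ord (b i))).

(** [inord] falls back to 0 when an exponent exceeds l; the condition [mwt b < l] in the lemmas
    below excludes this. In [decr] the truncated subtraction leaves b unchanged when [b j] is 0. *)
Definition incr (j : 'I_d) (b : mindex) : mindex := [ffun i => inord (b i + (i == j))].
Definition decr (j : 'I_d) (b : mindex) : mindex := [ffun i => inord (b i - (i == j))].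

Lemma leq_wt (b : mindex) i : (b i <= mwt b)%N.
Proof. by rewrite /wt (bigD1 i)//= leq_addr. Qed.

Lemma incrE j (b : mindex) i : (mwt b < l)%N -> incr j b i = (b i + (i == j))%N :> nat.
Proof.
move=> bl; rewrite ffunE inordK// ltnS (leq_trans _ bl)//.
by rewrite (leq_trans (leq_add (leq_wt b i) (leq_b1 _)))// addn1.
Qed.

Lemma decrE j (b : mindex) i : decr j b i = (b i - (i == j))%N :> nat.
Proof. by rewrite ffunE inordK// ltnS (leq_trans (leq_subr _ _))// -ltnS. Qed.

Lemma wt_incr j (b : mindex) : (mwt b < l)%N -> mwt (incr j b) = (mwt b).+1.
Proof.
move=> bl; rewrite /wt; under eq_bigr do rewrite incrE//.
rewrite big_split/= -[RHS]addn1; congr (_ + _)%N.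
by rewrite (bigD1 j)//= eqxx big1 ?addn0// => i /negbTE ->.
Qed.

Lemma incrK j (b : mindex) : (mwt b < l)%N -> decr j (incr j b) = b.
Proof. by move=> bl; apply/ffunP => i; apply/val_inj; rewrite /= decrE incrE// addnK. Qed.

Lemma decrK j (b : mindex) : (0 < b j)%N -> (mwt b <= l)%N ->
  (mwt (decr j b)).+1 = mwt b /\ incr j (decr j b) = b.
Proof.
move=> bj bl; have e : ((mwt (decr j b)).+1 = mwt b)%N.
  rewrite /wt; under eq_bigr do rewrite decrE.
  rewrite (bigD1 j)//= [RHS](bigD1 j)//= eqxx -addSn subn1 prednK//; congr (_ + _)%N.
  by apply: eq_bigr => i /negbTE ->; rewrite subn0.
split => //; apply/ffunP => i; apply/val_inj; rewrite /= incrE ?e// decrE.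
by case: eqP => [->|_]; rewrite ?subnK ?subn0 ?addn0.
Qed.

(** On these index sets [incr j] and [decr j] are inverse bijections. The reindexing serves
    multiplication by a coordinate in [pol_coef] and differentiation in [partial_primitive]. *)
Lemma sum_incr (V : nmodType) (j : 'I_d) n (F : mindex -> V) : (n <= l)%N ->
  \sum_(b : mindex | (mwt b < n.+1)%N && (0 < b j)%N) F b =
  \sum_(b : mindex | (mwt b < n)%N) F (incr j b).
Proof.
move=> nl; rewrite (reindex_onto (incr j) (decr j))/=; last first.
  by move=> b /andP[bn bj]; have [] := decrK bj (leq_trans (bn : (mwt b <= n)%N) nl).
apply: eq_bigl => b; apply/idP/idP => [/andP[/andP[h1 h2] /eqP h3]|bn].
  have [e _] : (mwt (decr j (incr j b))).+1 = mwt (incr j b) /\ _ := decrK h2 (leq_trans (h1 : (mwt (incr j b) <= n)%N) nl).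
  by rewrite h3 in e; rewrite e.
have bl : (mwt b < l)%N by exact: leq_trans nl.
by rewrite wt_incr// ltnS bn incrE// eqxx addn1 incrK/= ?eqxx.
Qed.

End MultiIndex.
Arguments mindex : clear implicits.
Notation mwt b := (wt (fun i => nat_of_ord (b i))).

Section Polynomials.
Context {R : realType} {d : nat}.

(* [pol n f] says that f is a polynomial of degree < n, so that n = 0 leaves
   only the zero polynomial. *)
Inductive pol : nat -> ('rV[R]_d -> R) -> Prop :=
| pol_zero n : pol n (fun=> 0)
| pol_cst n c : pol n.+1 (fun=> c)
| polD n f g : pol n f -> pol n g -> pol n (fun x => f x + g x)
| polX n i f : pol n f -> pol n.+1 (fun x => x 0 i * f x).

Lemma polS n f : pol n f -> pol n.+1 f.
Proof.
by elim=> *; [exact: pol_zero|exact: pol_cst|exact: polD|exact: polX].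
Qed.

Lemma leq_pol m n f : (m <= n)%N -> pol m f -> pol n f.
Proof. by move=> /subnKC <- pf; elim: (n - m)%N => [|k IH]; rewrite ?addn0 ?addnS//; exact: polS. Qed.

Lemma polZ n c f : pol n f -> pol n (fun x => c * f x).
Proof.
elim=> {n f} [n|n e|n f g _ IHf _ IHg|n i f _ IH].
- by under eq_fun do rewrite mulr0; exact: pol_zero.
- exact: pol_cst.
- by under eq_fun do rewrite mulrDr; exact: polD.
- by under eq_fun do rewrite mulrCA; exact: polX.
Qed.

Lemma pol_sum n I (s : seq I) (P : pred I) (F : I -> 'rV[R]_d -> R) :
  (forall i, P i -> pol n (F i)) -> pol n (fun x => \sum_(i <- s | P i) F i x).
Proof.
move=> pF; elim: s => [|i s IH]; first by under [X in pol _ X]eq_fun do rewrite big_nil; exact: pol_zero.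
rewrite (_ : (fun x => _) = if P i then (fun x => F i x + \sum_(j <- s | P j) F j x)
  else (fun x => \sum_(j <- s | P j) F j x)); last by apply/funext => x; rewrite big_cons; case: ifP.
case: ifP => // Pi.
by apply: polD => //; exact: pF.
Qed.

Definition aff (A : 'M[R]_d) (c : 'rV[R]_d) (x : 'rV[R]_d) : 'rV[R]_d := x *m A + c.

Lemma affE A c x i : aff A c x 0 i = \sum_j A j i * x 0 j + c 0 i.
Proof. by rewrite !mxE; congr (_ + _); apply: eq_bigr => j _; rewrite mulrC. Qed.

Lemma pol_mul_aff n A c i f : pol n f -> pol n.+1 (fun x => aff A c x 0 i * f x).
Proof.
move=> pf; under eq_fun do rewrite affE mulrDl mulr_suml.
apply: polD; last by apply: polZ; exact: polS.
apply: pol_sum => j _; under eq_fun do rewrite -mulrA.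
by apply: polZ; exact: polX.
Qed.

Lemma pol_aff n A c f : pol n f -> pol n (f \o aff A c).
Proof.
elim=> {n f} [n|n e|n f g _ IHf _ IHg|n i f _ IH]; first exact: pol_zero.
- exact: pol_cst.
- exact: polD.
- exact: pol_mul_aff.
Qed.

Lemma pol_monomial A c (b : 'I_d -> nat) :
  pol (wt b).+1 (fun x => \prod_i aff A c x 0 i ^+ b i).
Proof.
rewrite /wt; elim: (index_enum _) => [|i s IH].
  by under [X in pol _ X]eq_fun do rewrite big_nil; exact: pol_cst.
rewrite big_cons; under [X in pol _ X]eq_fun do rewrite big_cons.
elim: (b i) => [|n IHn]; first by under [X in pol _ X]eq_fun do rewrite expr0 mul1r.
by under [X in pol _ X]eq_fun do rewrite exprS -mulrA; exact: pol_mul_aff.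
Qed.

(** This covers m = -1 with n = 0, the case l = 0 of the theorem: exponents then range over two
    values, but no total degree is <= -1, so the sum is empty and f = 0. *)
Lemma is_poly_pol m n (f : 'rV[R]_d -> R) : (m < n%:Z)%R -> is_poly m f -> pol n f.
Proof.
move=> mn [c fE]; rewrite (_ : f = fun x => \sum_(a : {ffun 'I_d -> 'I_(`|m|%N.+1)}
   | ((\sum_i (a i : nat))%:Z <= m)) c a * \prod_i (x 0 i) ^+ (a i)); last exact/funext.
apply: pol_sum => a am; apply: polZ.
apply: (@leq_pol (mwt a).+1); first by rewrite -ltz_nat; exact: le_lt_trans mn.
rewrite (_ : (fun x => _) = (fun x => \prod_i aff 1%:M 0 x 0 i ^+ a i)); last first.
  by apply/funext => x; rewrite /aff mulmx1 addr0.
exact: pol_monomial.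
Qed.

Lemma pol_coef l n f : (n <= l.+1)%N -> pol n f ->
  exists q : mindex d l -> R, forall x,
    f x = \sum_(b : mindex d l | (mwt b < n)%N) q b * \prod_i x 0 i ^+ b i.
Proof.
move=> nl pf; elim: pf nl => {n f} [n|n c|n f g _ IHf _ IHg|n i f _ IH] nl.
- by exists (fun=> 0) => x; rewrite big1// => b _; rewrite mul0r.
- exists (fun b => if b == [ffun=> ord0] then c else 0) => x.
  rewrite (bigD1 [ffun=> ord0])/=; last by rewrite /wt big1// => i _; rewrite ffunE.
  rewrite eqxx big1 ?mulr1; last by move=> i _; rewrite ffunE expr0.
  by rewrite big1 ?addr0// => b /andP[_ /negbTE ->]; rewrite mul0r.
- have [[p fE] [q gE]] := (IHf nl, IHg nl).
  exists (fun b => p b + q b) => x; rewrite fE gE -big_split/=.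
  by apply: eq_bigr => b _; rewrite mulrDl.
- have [q fE] := IH (ltnW nl).
  (* Multiplication by the i-th coordinate moves the coefficient at [decr i b] to b. An index with
     [b i] = 0 is not reached and gets 0. *)
  exists (fun b : mindex d l => if (0 < b i)%N then q (decr i b) else 0) => x.
  under [RHS]eq_bigr do rewrite (fun_if (fun z => z * _)) mul0r.
  rewrite -big_mkcondr/= sum_incr// fE mulr_sumr; apply: eq_bigr => b bn.
  have bl : (mwt b < l)%N by exact: leq_trans bn nl.
  rewrite incrK// mulrCA; congr (_ * _).
  rewrite (bigD1 i)//= [RHS](bigD1 i)//= incrE// eqxx addn1 exprS -mulrA; congr (_ * (_ * _)).
  by apply: eq_bigr => j /negbTE ji; rewrite incrE// ji addn0.
Qed.

Lemma pol_is_poly (l : nat) (f : 'rV[R]_d -> R) : pol l.+1 f -> is_poly l%:Z f.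
Proof.
move=> /(pol_coef (leqnn l.+1))[q fE]; exists q => x; rewrite fE.
by apply: eq_bigl => b; rewrite lez_nat ltnS.
Qed.

End Polynomials.

(** * Products of functions of the affine coordinates *)

Section ProductFunctions.
Context {R : realType} {d : nat}.
Implicit Types (u w : nat -> R -> R) (b : 'I_d -> nat) (x y : 'rV[R]_d).

(** Both the Y_b, with u = [monom], and the Psi_b, with u = [eta], are of this form after
    composition with [aff A c]. *)
Definition prodf u b y : R := \prod_i u (b i) (y 0 i).

Lemma is_derive_line (f : 'rV[R]_d -> R) x v (D : R) :
  is_derive (0 : R) (1 : R) (fun h : R => f (h *: v + x)) D -> is_derive x v f D.
Proof.
have e : (fun h : R => h^-1 *: ((f \o shift x) (h *: v) - f x)) =
    (fun h : R => h^-1 *: (((fun h : R => f (h *: v + x)) \o shift 0) (h *: (1 : R)) -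
       (fun h : R => f (h *: v + x)) 0)).
  by apply/funext => h /=; rewrite scale0r add0r addr0 /GRing.scale/= mulr1.
by move=> [dv De]; apply: DeriveDef; [rewrite /derivable e|rewrite -De /derive e].
Qed.

Lemma is_derive_prod (I : eqType) (s : seq I) (f df : I -> R -> R) (x : R) :
  uniq s -> (forall i, is_derive x (1 : R) (f i) (df i x)) ->
  is_derive x (1 : R) (fun h => \prod_(i <- s) f i h)
    (\sum_(j <- s) \prod_(i <- s) (if i == j then df i x else f i x)).
Proof.
move=> + fdf; elim: s => [_|a s IH /= /andP[sa us]].
  by under eq_fun do rewrite big_nil; rewrite big_nil; exact: is_derive_cst.
under eq_fun do rewrite big_cons.
apply: is_derive_eq (is_deriveM (fdf a) (IH us)) _.
rewrite big_cons big_cons eqxx addrC /GRing.scale/=; congr (_ + _).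
  rewrite mulrC; congr (_ * _); apply: eq_big_seq => i si.
  by case: eqP => // ia; rewrite -ia si in sa.
rewrite mulr_sumr; apply: eq_big_seq => j sj; rewrite big_cons.
by case: eqP => // aj; rewrite aj sj in sa.
Qed.

Lemma is_derive_prodf u w A (c : 'rV[R]_d) b x k :
  (forall n (t : R), is_derive t (1 : R) (u n) (w n t)) ->
  is_derive x (delta_mx 0 k) (prodf u b \o aff A c)
    (\sum_j A k j * \prod_i (if i == j then w (b i) (aff A c x 0 i) else u (b i) (aff A c x 0 i))).
Proof.
move=> uw; apply: is_derive_line.
have lE h i : aff A c (h *: delta_mx 0 k + x) 0 i = h * A k i + aff A c x 0 i.
  by rewrite /aff mulmxDl -scalemxAl -rowE -addrA [LHS]mxE; congr (_ + _); rewrite !mxE.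
have dl (i : 'I_d) : is_derive (0 : R) (1 : R)
    (fun h : R => u (b i) (h * A k i + aff A c x 0 i)) (w (b i) (aff A c x 0 i) * A k i).
  have dlin : is_derive (0 : R) (1 : R) (fun h : R => h * A k i + aff A c x 0 i) (A k i).
    have := is_deriveD (is_deriveM (is_derive_id (0 : R) (1 : R)) (is_derive_cst (A k i) 0 (1 : R)))
      (is_derive_cst (aff A c x 0 i) (0 : R) (1 : R)).
    move/is_derive_eq; apply.
    by rewrite /GRing.scale/= mulr0 add0r addr0 mulr1.
  have := uw (b i) (0 * A k i + aff A c x 0 i) => dui.
  have := @is_derive1_comp _ (u (b i)) (fun h : R => h * A k i + aff A c x 0 i) _ _ _ dui dlin.
  by rewrite mul0r add0r.
have := @is_derive_prod _ (index_enum 'I_d) _ (fun i _ => w (b i) (aff A c x 0 i) * A k i) 0 (index_enum_uniq _) dl.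
rewrite (_ : (fun h : R => \prod_(i <- _) _) = fun h : R => (prodf u b \o aff A c) (h *: delta_mx 0 k + x)); last first.
  by apply/funext => h; rewrite /prodf/=; apply: eq_bigr => i _; rewrite lE.
move/is_derive_eq; apply; apply: eq_bigr => j _.
rewrite (bigD1 j)//= [in RHS](bigD1 j)//= !eqxx [w _ _ * _]mulrC -mulrA; congr (_ * (_ * _)).
apply: eq_bigr => i /negbTE ->.
by rewrite mul0r add0r.
Qed.

Lemma cvg_sumr T (F : set_system T) {FF : Filter F} I (s : seq I) (g : I -> T -> R) (y : I -> R) :
  (forall i, g i t @[t --> F] --> y i) -> \sum_(i <- s) g i t @[t --> F] --> \sum_(i <- s) y i.
Proof.
move=> gy; elim: s => [|i s IH].
  by rewrite big_nil; under eq_fun do rewrite big_nil; exact: cvg_cst.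
by rewrite big_cons; under eq_fun do rewrite big_cons; exact: cvgD.
Qed.

Lemma cvg_prodr T (F : set_system T) {FF : Filter F} I (s : seq I) (g : I -> T -> R) (y : I -> R) :
  (forall i, g i t @[t --> F] --> y i) -> \prod_(i <- s) g i t @[t --> F] --> \prod_(i <- s) y i.
Proof.
move=> gy; elim: s => [|i s IH].
  by rewrite big_nil; under eq_fun do rewrite big_nil; exact: cvg_cst.
by rewrite big_cons; under eq_fun do rewrite big_cons; exact: cvgM.
Qed.

Lemma continuous_coord (i : 'I_d) A c : continuous (fun x : 'rV[R]_d => aff A c x 0 i).
Proof.
move=> x; rewrite /continuous_at affE.
rewrite (_ : (fun x => _) = fun x => \sum_j A j i * x 0 j + c 0 i); last first.
  by apply/funext => z; rewrite affE.
have FF : Filter (nbhs x) by exact: nbhs_filter.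
have h : \sum_j A j i * z 0 j @[z --> x] --> \sum_j A j i * x 0 j.
  apply: (@cvg_sumr _ _ FF) => j.
  by apply: (@cvgM _ _ _ FF); [exact: (@cvg_cst _ _ _ _ FF)|exact: coord_continuous].
exact: (@cvgD _ _ _ _ FF _ _ _ _ h (@cvg_cst _ _ _ _ FF)).
Qed.

Lemma continuous_prodf u A c b : (forall n, continuous (u n)) ->
  continuous (prodf u b \o aff A c).
Proof.
move=> cu x; apply: (@cvg_prodr _ (nbhs x) (nbhs_filter x)) => i.
exact: (continuous_comp (@continuous_coord i A c x) (cu _ _)).
Qed.

End ProductFunctions.

(** * Products of kernels as test functions *)

Section TestFunctions.
Context {R : realType} {d : nat}.
Variables (A : 'M[R]_d) (c : 'rV[R]_d) (u : nat -> R -> R).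
Hypothesis du : forall n (t : R), is_derive t (1 : R) (u n) (u n.+1 t).

Definition shift_index (j : 'I_d) (b : 'I_d -> nat) : 'I_d -> nat := fun i => (b i + (i == j))%N.

Lemma partial_prodf b k x : is_derive x (delta_mx 0 k) (prodf u b \o aff A c)
  (\sum_j A k j * (prodf u (shift_index j b) \o aff A c) x).
Proof.
apply: is_derive_eq (is_derive_prodf A c b x k du) _.
apply: eq_bigr => j _; congr (_ * _); apply: eq_bigr => i _; rewrite /shift_index.
by case: eqP => _; rewrite ?addn1 ?addn0.
Qed.

(** The linear span of the products is stable under every partial derivative, because [u] is a
    sequence of successive derivatives. Smoothness then follows by induction on the list of
    directions. *)
Inductive prodf_span : ('rV[R]_d -> R) -> Prop :=
| prodf_span0 : prodf_span (fun=> 0)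
| prodf_spanD a b f : prodf_span f ->
    prodf_span (fun x => a * (prodf u b \o aff A c) x + f x).

Lemma prodf_span_add f g : prodf_span f -> prodf_span g -> prodf_span (fun x => f x + g x).
Proof.
move=> + sg; elim=> [|a b {}f _ IH]; first by under eq_fun do rewrite add0r.
by under eq_fun do rewrite -addrA; constructor.
Qed.

Lemma prodf_spanZ a f : prodf_span f -> prodf_span (fun x => a * f x).
Proof.
elim=> [|e b {}f _ IH]; first by under eq_fun do rewrite mulr0; constructor.
by under eq_fun do rewrite mulrDr mulrA; constructor.
Qed.

Lemma prodf_span_base b : prodf_span (prodf u b \o aff A c).
Proof.
have := prodf_spanD 1 b prodf_span0.
by under eq_fun do rewrite mul1r addr0.
Qed.

Lemma prodf_span_sum I (s : seq I) (F : I -> 'rV[R]_d -> R) :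
  (forall i, prodf_span (F i)) -> prodf_span (fun x => \sum_(i <- s) F i x).
Proof.
move=> sF; elim: s => [|i s IH].
  by under eq_fun do rewrite big_nil; constructor.
by under eq_fun do rewrite big_cons; exact: prodf_span_add.
Qed.

Lemma prodf_span_continuous f : prodf_span f -> continuous f.
Proof.
have cu n : continuous (u n).
  by move=> x; apply/differentiable_continuous/derivable1_diffP; case: (du n x).
elim=> [|a b {}f _ IH] x; first exact: (@cvg_cst _ _ _ _ (nbhs_filter x)).
have FF : Filter (nbhs x) by exact: nbhs_filter.
have h : a * (prodf u b \o aff A c) z @[z --> x] --> a * (prodf u b \o aff A c) x.
  by apply: (@cvgM _ _ _ FF); [exact: (@cvg_cst _ _ _ _ FF)|exact: continuous_prodf].
exact: (@cvgD _ _ _ _ FF _ _ _ _ h (IH x)).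
Qed.

Lemma prodf_span_partial f k : prodf_span f ->
  (forall x, derivable f x (delta_mx 0 k)) /\ prodf_span (partial k f).
Proof.
move=> sf; suff [g sg dg] : exists2 g, prodf_span g & forall x, is_derive x (delta_mx 0 k) f (g x).
  split=> [x|]; first by case: (dg x).
  by rewrite (_ : partial k f = g)//; apply/funext => x; rewrite /partial derive_val.
elim: sf => {f} [|a b f _ [g sg dg]].
  by exists (fun=> 0) => [|x]; [constructor|exact: is_derive_cst].
exists (fun x => a * (\sum_j A k j * (prodf u (shift_index j b) \o aff A c) x) + g x).
  apply: prodf_span_add => //; apply: prodf_spanZ; apply: prodf_span_sum => j.
  exact/prodf_spanZ/prodf_span_base.
move=> x; exact: is_deriveD (is_deriveZ a (partial_prodf b k x)) (dg x).
Qed.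

Lemma prodf_span_smooth f : prodf_span f -> smooth f.
Proof.
move=> sf s; have : prodf_span (iter_partial s f).
  by elim: s => //= k s /(@prodf_span_partial _ k)[].
move=> sg; split; first exact: prodf_span_continuous.
by move=> k x; have [] := prodf_span_partial k sg.
Qed.

Variables (r r' : R) (M : 'M[R]_d) (e : 'rV[R]_d) (K : set 'rV[R]_d).
Hypothesis rr' : r < r'.
Hypothesis su : forall n, supported r (u n).
Hypotheses (affK : cancel (aff A c) (aff M e)) (affK' : cancel (aff M e) (aff A c)).
Hypothesis Kr : forall x, (forall i, `|aff A c x 0 i| < r') -> K x.

Lemma aff_continuous (N : 'M[R]_d) (f : 'rV[R]_d) : continuous (aff N f).
Proof.
move=> x; apply/(@cvg_ballP _ _ _ _ (nbhs_filter x)) => eps eps0.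
have : \forall z \near x, forall i : 'I_d, ball (aff N f x 0 i) eps (aff N f z 0 i).
  apply: (@filter_forall _ _ _ _ (nbhs_filter x)) => i.
  exact: (@cvg_ball _ _ _ _ (nbhs_filter x) _ _ (@continuous_coord _ _ i N f x) _ eps0).
by apply: (@filterS _ _ (nbhs_filter x)) => z h; split=> // i j; rewrite ord1; exact: h.
Qed.

Lemma prodf_supported b x : (exists i, r < `|aff A c x 0 i|) -> (prodf u b \o aff A c) x = 0.
Proof. by move=> [i ri]; rewrite /prodf/= (bigD1 i)//= su// mul0r. Qed.

(** The support lies in the image of the cube [-r, r]^d under the inverse affine map, which is
    compact. The gap r < r' surrounds each of its points by a neighbourhood contained in K. *)
Lemma prodf_test_fun b : test_fun K (prodf u b \o aff A c).
Proof.
split; first exact/prodf_span_smooth/prodf_span_base.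
exists [set x | forall i, `|aff A c x 0 i| <= r]; split.
- have -> : [set x | forall i, `|aff A c x 0 i| <= r] =
      aff M e @` [set y : 'rV[R]_d | forall i, [set` `[-r, r]] (y ord0 i)].
    apply/seteqP; split => [x /= h|_ [y /= h <-] i].
      exists (aff A c x); last by rewrite affK.
      by move=> i /=; rewrite in_itv/= -ler_norml; exact: h.
    by have := h i; rewrite affK' /= in_itv/= -ler_norml.
  apply: continuous_compact.
    exact/continuous_subspaceT/aff_continuous.
  exact: (@rV_compact R d (fun=> `[-r, r]%classic) (fun=> @segment_compact _ _ _)).
- move=> x /= h; apply: (@filterS _ (nbhs x) (nbhs_filter x) [set z | forall i, `|aff A c z 0 i| < r']).
    by move=> z /= hz; exact: Kr.
  apply: (@filter_forall _ _ _ _ (nbhs_filter x)) => i.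
  have := @cvgr_norm_lt R R^o _ (nbhs x) (nbhs_filter x) (fun z => aff A c z 0 i) _ (@continuous_coord _ _ i A c x).
  by apply; exact: le_lt_trans rr'.
- move=> x /= h; apply: prodf_supported; apply: contrapT => h'; apply: h => i.
  by rewrite leNgt; apply/negP => ri; apply: h'; exists i.
Qed.

End TestFunctions.

(** * The averaged Taylor projection *)

Section Projection.
Context {R : realType} {d l : nat}.
Local Notation borel := (measurableTypeR R).
Variables (eta : nat -> R -> R) (Beta : nat -> R) (r r' : R).
Hypothesis smooth_eta : forall b, smooth1 (eta b).
Hypothesis derive_eta : forall b (x : R), is_derive x (1 : R) (eta b) (eta b.+1 x).
Hypothesis supported_eta : forall b, supported r (eta b).
Hypothesis moment_eta : forall k b, (k <= l)%N -> (b <= l)%N ->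
  moment k (eta b) = (-1) ^+ b * (k == b)%:R.
Hypothesis bound_eta : forall b x, `|eta b x| <= Beta b.
Variables (A M : 'M[R]_d) (c e : 'rV[R]_d) (K K0 : set 'rV[R]_d) (gamma : R).
Hypotheses (affK : cancel (aff A c) (aff M e)) (affK' : cancel (aff M e) (aff A c)).
Hypothesis scaling : volume_scaling (aff M e) gamma.
Hypothesis KK0 : forall x, K x <-> K0 (aff A c x).
Hypothesis mK0 : mrow (\1_K0 : 'rV[R]_d -> borel).
Hypothesis iK0 : rintegrable (\1_K0 : 'rV[R]_d -> R).
Hypothesis K0_le1 : forall y i, K0 y -> `|y 0 i| <= 1.
Hypotheses (rr' : r < r') (K0_ball : forall y : 'rV[R]_d, (forall i, `|y 0 i| < r') -> K0 y).

Let Psi (b : 'I_d -> nat) := prodf eta b \o aff A c.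
Let Y (b : 'I_d -> nat) := prodf (@monom R) b \o aff A c.

Let gamma0 : 0 < gamma. Proof. by case: scaling. Qed.

Lemma indicK x : \1_K x = \1_K0 (aff A c x) :> R.
Proof. by rewrite !indicE; congr (_%:R); congr nat_of_bool; apply/idP/idP; rewrite !inE => /KK0. Qed.

Lemma indic01 (x : 'rV[R]_d) : 0 <= (\1_K x : R) <= 1.
Proof. by rewrite indicE; case: (_ \in _); rewrite ?lexx ?ler01. Qed.

Lemma mrow_indicK : mrow (\1_K : 'rV[R]_d -> borel).
Proof. by rewrite (_ : \1_K = \1_K0 \o aff A c) ?funeqE; [exact: mrow_affine|exact: indicK]. Qed.

Lemma RI_indicK : rintegrable (\1_K : 'rV[R]_d -> R) /\ RI (\1_K : _ -> R) = gamma * RI (\1_K0 : _ -> R).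
Proof.
have e0 : \1_K \o aff M e = (\1_K0 : _ -> R) by apply/funext => y; rewrite /= indicK affK'.
by have := @RI_scaling _ _ _ _ _ scaling mrow_indicK; rewrite e0; apply.
Qed.

Lemma mrow_prodf (u : nat -> R -> R) b (N : 'M[R]_d) f : (forall n, continuous (u n)) ->
  mrow ((prodf u b \o aff N f) : _ -> borel).
Proof.
move=> cu; have mu : mrow (prodf u b : _ -> borel).
  rewrite /mrow (_ : _ \o _ = fun t => \prod_i u (b i) (tnth t i)); last first.
    by apply/funext => t; apply: eq_bigr => i _; rewrite mxE.
  elim: (index_enum _) => [|i s IH].
    by under eq_fun do rewrite big_nil; exact: measurable_cst.
  under eq_fun do rewrite big_cons; apply: measurable_funM => //.
  apply: measurableT_comp (measurable_tnth i).
  exact: continuous_measurable_fun.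
exact: mrow_affine.
Qed.

Let ceta n : continuous (eta n). Proof. exact: smooth1_continuous. Qed.
Let cmonom n : continuous (@monom R n). Proof. exact/smooth1_continuous/smooth1_monom. Qed.

Lemma Psi_bound b x : `|Psi b x| <= \prod_i Beta (b i).
Proof.
rewrite /Psi /prodf/= normr_prod; apply: ler_prod => i _.
by rewrite normr_ge0 bound_eta.
Qed.

Lemma Psi_K b x : \1_K x * Psi b x = Psi b x.
Proof.
rewrite indicK indicE; have [_|] := boolP (_ \in _); first by rewrite mul1r.
rewrite notin_setE => nK; rewrite mul0r; apply/esym; rewrite /Psi.
apply: (prodf_supported supported_eta); apply: contrapT => h; apply: nK; apply: K0_ball => i.
rewrite ltNge; apply/negP => ri; apply: h; exists i; exact: lt_le_trans ri.
Qed.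

Lemma Y_le1 b x : K x -> `|Y b x| <= 1.
Proof.
move=> /KK0 Kx; rewrite /Y /prodf/= normr_prod; apply: prodr_ile1 => i _.
rewrite normr_ge0/= /monom normrM normrX normfV (ger0_norm (ler0n _ _)).
rewrite ler_pdivrMr ?ltr0n ?fact_gt0// mul1r.
by rewrite (le_trans (exprn_ile1 _ _ _))// ?K0_le1// ler1n fact_gt0.
Qed.

(** In the coordinates [aff A c] the integrand is a product of functions of one variable, so the
    integral is gamma times a product of moments, each of which is a signed Kronecker symbol. *)
Lemma RI_Y_Psi (a b : 'I_d -> nat) : (forall i, (a i <= l)%N) -> (forall i, (b i <= l)%N) ->
  rintegrable (fun x => Y a x * Psi b x) /\
  RI (fun x => Y a x * Psi b x) = gamma * ((-1) ^+ wt b * [forall i, a i == b i]%:R).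
Proof.
move=> al bl; pose f i : R -> R := monom (a i) * eta (b i).
have [ip ep] := @integral_prod _ _ f (fun i => smooth1_integrable (smooth1M (smooth1_monom R (a i)) (smooth_eta (b i))) (@supportedMl R r _ _ (@supported_eta (b i)))).
have e0 : (fun x => Y a x * Psi b x) \o aff M e \o @row_of_tuple R d = fun t => \prod_i f i (tnth t i).
  apply/funext => t /=; rewrite /Y /Psi /prodf/= affK' -big_split/=.
  by apply: eq_bigr => i _; rewrite mxE.
have mYP : mrow ((fun x => Y a x * Psi b x) : _ -> borel).
  by apply: measurable_funM; exact: mrow_prodf.
have iA : rintegrable ((fun x => Y a x * Psi b x) \o aff M e) by rewrite /rintegrable e0.
have [i1 ->] := RI_scaling scaling mYP iA; split => //; congr (_ * _).
rewrite [LHS](_ : _ = \int[tmeas R d]_t (\prod_i f i (tnth t i))); last first.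
  by apply: eq_Rintegral => t _; exact: (congr1 (fun g => g t) e0).
rewrite ep (eq_bigr (fun i => (-1) ^+ b i * (a i == b i)%:R)); last first.
  by move=> i _; rewrite -moment_eta.
rewrite big_split/= -expr_sum; congr (_ * _).
have [/forallP ab|/forallPn[i abi]] := boolP [forall i, a i == b i].
  by rewrite big1// => i _; rewrite ab.
by rewrite (bigD1 i)//= (negbTE abi) mul0r.
Qed.

Definition sqint (f : 'rV[R]_d -> R) :=
  mrow (f : _ -> borel) /\ rintegrable (fun x => \1_K x * f x ^+ 2).

(** On K, |f| <= f^2 + 1, which is integrable since K has finite volume, and Psi_b is bounded. *)
Lemma sqint_integrable f b : sqint f -> rintegrable (fun x => \1_K x * f x * Psi b x).
Proof.
move=> [mf f2]; have [iK _] := RI_indicK.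
have B0 : 0 <= \prod_i Beta (b i) by exact: le_trans (Psi_bound b 0).
apply: (@rintegrable_le _ _ _ (fun x => \prod_i Beta (b i) * (\1_K x * f x ^+ 2 + \1_K x))).
- apply: measurable_funM; last exact: mrow_prodf.
  apply: measurable_funM => //; exact: mrow_indicK.
- by apply: rintegrableZ; exact: rintegrableD.
- move=> x; rewrite normrM mulrC ler_pM// ?Psi_bound// normrM.
  have /andP[k0 _] := indic01 x; rewrite ger0_norm// -[X in _ + X]mulr1 -mulrDr ler_wpM2l//.
  by rewrite -(real_normK (num_real (f x))); have := sqr_ge0 (`|f x| - 1); nra.
Qed.

(* Up to the sign (-1)^|b|, the average of the derivative of multi-index b of f,
   taken in the coordinates [aff A c]. *)
Definition weight b f := RI (fun x => \1_K x * f x * Psi b x).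

Lemma sqint_integrable1 f : sqint f -> rintegrable (fun x => \1_K x * `|f x|).
Proof.
move=> [mf f2]; have [iK _] := RI_indicK.
apply: (@rintegrable_le _ _ _ (fun x => \1_K x * f x ^+ 2 + \1_K x)).
- by apply: measurable_funM; [exact: mrow_indicK|exact: measurableT_comp].
- exact: rintegrableD.
- move=> x; have /andP[k0 _] := indic01 x.
  rewrite normrM normr_id ger0_norm// -[X in _ + X]mulr1 -mulrDr ler_wpM2l//.
  by rewrite -(real_normK (num_real (f x))); have := sqr_ge0 (`|f x| - 1); nra.
Qed.

(* Cauchy-Schwarz, from the nonnegativity of the integral of (|f| - t)^2. *)
Lemma sqint_cauchy_schwarz f : sqint f ->
  RI (fun x => \1_K x * `|f x|) ^+ 2 <= RI (\1_K : _ -> R) * RI (fun x => \1_K x * f x ^+ 2).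
Proof.
move=> sf; have [mf f2] := sf; have [iK _] := RI_indicK; have f1 := sqint_integrable1 sf.
set n1 := RI (fun x => \1_K x * `|f x|); set k := RI (\1_K); set n2 := RI _.
have q t : 0 <= n2 - t * n1 *+ 2 + t ^+ 2 * k.
  have -> : n2 - t * n1 *+ 2 + t ^+ 2 * k =
     RI (fun x => \1_K x * f x ^+ 2 + (- t * 2 * (\1_K x * `|f x|) + t ^+ 2 * \1_K x)).
    have iZ1 := rintegrableZ (- t * 2) f1; have iZ2 := rintegrableZ (t ^+ 2) iK.
    by rewrite !RID ?RIZ//; [rewrite -/k -/n1 -/n2; ring|exact: rintegrableD].
  apply: RI_ge0 => x; have /andP[k0 _] := indic01 x.
  have -> : \1_K x * f x ^+ 2 + (- t * 2 * (\1_K x * `|f x|) + t ^+ 2 * \1_K x) = \1_K x * (`|f x| - t) ^+ 2.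
    by rewrite -(real_normK (num_real (f x))); ring.
  by rewrite mulr_ge0// sqr_ge0.
have k0 : 0 <= k by apply: RI_ge0 => x; have /andP[] := indic01 x.
(* If K is null the quadratic is affine in t, and a nonzero slope would make it negative at t = (n2
   + 1) / n1. Otherwise t = n1 / k is its minimizer and gives the inequality. *)
have [kz|kp] := eqVneq k 0.
  have n10 : 0 <= n1 by apply: RI_ge0 => x; have /andP[h _] := indic01 x; rewrite mulr_ge0.
  have [->|n1p] := eqVneq n1 0; first by rewrite expr0n/= kz mul0r.
  have := q ((n2 + 1) / n1); rewrite kz mulr0 addr0 divfK//; have := q 0.
  by rewrite !mul0r mul0rn expr0n/= mul0r subr0 addr0; lra.
have {}kp : 0 < k by rewrite lt_neqAle eq_sym kp.
have := q (n1 / k).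
have -> : n2 - n1 / k * n1 *+ 2 + (n1 / k) ^+ 2 * k = n2 - n1 ^+ 2 / k by field; rewrite gt_eqF.
by rewrite subr_ge0 ler_pdivrMr// mulrC.
Qed.

Definition Bmax : R := \sum_(b : mindex d l) \prod_i `|Beta (b i)|.

Lemma weight_bound (b : mindex d l) f : sqint f ->
  `|weight (fun i => b i) f| <= Bmax * RI (fun x => \1_K x * `|f x|).
Proof.
move=> sf; have ib := sqint_integrable (fun i => b i : nat) sf; have i1 := sqint_integrable1 sf.
have [_ iabs] := integrable_nonneg_split ib.
apply: le_trans (le_normr_Rintegral measurableT ib) _.
rewrite -RIZ//; apply: le_Rintegral => //; first exact: (rintegrableZ _ i1).
move=> t _ /=; set x := row_of_tuple t; rewrite !normrM mulrC.
have /andP[k0 _] := indic01 x; rewrite (ger0_norm k0) ler_wpM2r//.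
apply: (le_trans (Psi_bound _ _)); rewrite /Bmax (bigD1 b)//=.
apply: le_trans (ler_norm _) _; rewrite normr_prod lerDl.
by apply: sumr_ge0 => b' _; apply: prodr_ge0.
Qed.

Definition proj f x := \sum_(b : mindex d l | (mwt b < l)%N)
  ((-1) ^+ mwt b / gamma * weight (fun i => b i) f) * Y (fun i => b i) x.

(** A pointwise bound of [proj f] by the number of indices times [Bmax] times the L^1 norm of f over
    gamma is squared, which costs gamma^(-2). One factor gamma returns from the volume of K when
    integrating, the other from Cauchy-Schwarz, and the volume of K0 remains squared. *)
Definition proj_const : R := (#|{: mindex d l}|%:R * Bmax * RI (\1_K0 : _ -> R)) ^+ 2.

Lemma mrow_Y b : mrow (Y b : _ -> borel).
Proof. exact: mrow_prodf. Qed.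

Lemma mrow_proj f : mrow (proj f : _ -> borel).
Proof.
rewrite (_ : proj f = fun x => \sum_(b : mindex d l) if (mwt b < l)%N then
  ((-1) ^+ mwt b / gamma * weight (fun i => b i) f) * Y (fun i => b i) x else 0); last first.
  by apply/funext => x; rewrite /proj big_mkcond.
apply: measurable_sum => b; case: (mwt b < l)%N; last exact: measurable_cst.
apply: measurable_funM; [exact: measurable_cst|exact: mrow_Y].
Qed.

Lemma proj_bounded f : sqint f ->
  sqint (proj f) /\
  RI (fun x => \1_K x * proj f x ^+ 2) <= proj_const * RI (fun x => \1_K x * f x ^+ 2).
Proof.
move=> sf; have [iK eK] := RI_indicK.
set n1 := RI (fun x => \1_K x * `|f x|).
set N : R := #|{: mindex d l}|%:R.
have n10 : 0 <= n1 by apply: RI_ge0 => x; have /andP[h _] := indic01 x; rewrite mulr_ge0.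
have B0 : 0 <= Bmax by apply: sumr_ge0 => b' _; apply: prodr_ge0.
have pb x : K x -> `|proj f x| <= N * (Bmax * n1 / gamma).
  move=> Kx; apply: (le_trans (ler_norm_sum _ _ _)).
  rewrite big_mkcond/= /N -sum1_card natr_sum mulr_suml; apply: ler_sum => b _.
  rewrite mul1r; case: ifP => _; last by rewrite divr_ge0 ?mulr_ge0// ltW.
  rewrite 2!normrM -[leRHS]mulr1 ler_pM ?mulr_ge0//; last exact: Y_le1.
  rewrite normrM normrX normrN1 expr1n mul1r normfV (gtr0_norm gamma0) mulrC.
  by rewrite ler_wpM2r ?invr_ge0 ?(ltW gamma0)// weight_bound.
set D := N * (Bmax * n1 / gamma) in pb.
have pb2 x : \1_K x * proj f x ^+ 2 <= D ^+ 2 * \1_K x.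
  rewrite mulrC indicE; have [|] := boolP (x \in K); rewrite ?mulr0// inE => Kx.
  by rewrite !mulr1 -(real_normK (num_real (proj f x))) lerXn2r ?nnegrE// ?pb// (le_trans _ (pb x Kx)).
have p0 x : 0 <= \1_K x * proj f x ^+ 2.
  by have /andP[h _] := indic01 x; rewrite mulr_ge0// sqr_ge0.
have iD := rintegrableZ (D ^+ 2) iK.
have ip : rintegrable (fun x => \1_K x * proj f x ^+ 2).
  apply: rintegrable_le iD _; last by move=> x; rewrite ger0_norm.
  apply: measurable_funM; first exact: mrow_indicK.
  by apply: measurable_funX; exact: mrow_proj.
split; first by split => //; exact: mrow_proj.
apply: (le_trans (le_RI ip iD pb2)); rewrite RIZ// eK.
have cs := sqint_cauchy_schwarz sf; rewrite -/n1 eK in cs.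
set k0 := RI \1_K0 in cs *; set S := RI _ in cs *.
have k00 : 0 <= k0 by apply: RI_ge0 => x; rewrite indicE.
rewrite /proj_const -/N -/k0 /D.
have -> : (N * (Bmax * n1 / gamma)) ^+ 2 * (gamma * k0) = N ^+ 2 * Bmax ^+ 2 * k0 / gamma * n1 ^+ 2.
  by field; rewrite gt_eqF.
have -> : (N * Bmax * k0) ^+ 2 * S = N ^+ 2 * Bmax ^+ 2 * k0 / gamma * (gamma * k0 * S).
  by field; rewrite gt_eqF.
by rewrite ler_wpM2l// divr_ge0 ?(ltW gamma0)// !mulr_ge0 ?sqr_ge0.
Qed.


Lemma weightD b f g : sqint f -> sqint g ->
  weight b (fun x => f x + g x) = weight b f + weight b g.
Proof.
move=> sf sg; rewrite /weight -RID; [|exact: sqint_integrable..].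
by congr RI; apply/funext => x; ring.
Qed.

Lemma weightZ b a f : sqint f -> weight b (fun x => a * f x) = a * weight b f.
Proof.
move=> sf; rewrite /weight -RIZ; last exact: sqint_integrable.
by congr RI; apply/funext => x; ring.
Qed.

Lemma sqintD f g : sqint f -> sqint g -> sqint (fun x => f x + g x).
Proof.
move=> [mf f2] [mg g2]; split; first exact: measurable_funD.
apply: (@rintegrable_le _ _ _ (fun x => 2 * (\1_K x * f x ^+ 2 + \1_K x * g x ^+ 2))).
- apply: measurable_funM; first exact: mrow_indicK.
  by apply: measurable_funX; exact: measurable_funD.
- by apply: rintegrableZ; exact: rintegrableD.
- move=> x; have /andP[k0 _] := indic01 x.
  rewrite (ger0_norm (mulr_ge0 k0 (sqr_ge0 _))) -mulrDr [leRHS]mulrCA ler_wpM2l//.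
  by have := sqr_ge0 (f x - g x); nra.
Qed.

Lemma sqintZ a f : sqint f -> sqint (fun x => a * f x).
Proof.
move=> [mf f2]; split; first by apply: measurable_funM => //; exact: measurable_cst.
have := rintegrableZ (a ^+ 2) f2; congr rintegrable.
by apply/funext => x; ring.
Qed.

Lemma sqint_bounded f B : mrow (f : _ -> borel) -> (forall x, K x -> `|f x| <= B) -> sqint f.
Proof.
move=> mf fB; split=> //; apply: (@rintegrable_le _ _ _ (fun x => B ^+ 2 * \1_K x)).
- apply: measurable_funM; first exact: mrow_indicK.
  exact: measurable_funX.
- by have [iK _] := RI_indicK; exact: rintegrableZ.
- move=> x; rewrite mulrC indicE; have [|] := boolP (x \in K); last by rewrite !mulr0 normr0.
  rewrite inE => Kx; rewrite !mulr1 ger0_norm ?sqr_ge0//.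
  by rewrite -(real_normK (num_real (f x))) lerXn2r ?nnegrE// ?fB// (le_trans _ (fB x Kx)).
Qed.

Lemma sqintY b : sqint (Y b).
Proof. by apply: (@sqint_bounded _ 1); [exact: mrow_Y|exact: Y_le1]. Qed.

Lemma weight_sum b (I : finType) (P : pred I) (a : I -> R) (F : I -> 'rV[R]_d -> R) :
  (forall i, sqint (F i)) ->
  sqint (fun x => \sum_(i | P i) a i * F i x) /\
  weight b (fun x => \sum_(i | P i) a i * F i x) = \sum_(i | P i) a i * weight b (F i).
Proof.
move=> sF; elim: (index_enum _) => [|i s [IH1 IH2]].
  rewrite big_nil; rewrite (_ : (fun x => _) = (fun=> 0)); last by apply/funext => x; rewrite big_nil.
  split; first by apply: (@sqint_bounded _ 0) => [|x _]; [exact: measurable_cst|rewrite normr0].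
  rewrite /weight (_ : (fun x => _) = (fun=> 0)); last by apply/funext => x; rewrite mulr0 mul0r.
  by rewrite /RI Rintegral_cst// mul0r.
rewrite big_cons; rewrite (_ : (fun x => _) = if P i then (fun x => a i * F i x + \sum_(j <- s | P j) a j * F j x)
  else (fun x => \sum_(j <- s | P j) a j * F j x)); last first.
  by apply/funext => x; rewrite big_cons; case: ifP.
case: ifP => // _; split; first by apply: sqintD => //; exact: sqintZ.
by rewrite weightD ?weightZ ?IH2//; exact: sqintZ.
Qed.

Lemma weight_Y (a b : mindex d l) :
  weight (fun i => b i) (Y (fun i => a i)) = gamma * ((-1) ^+ mwt b * (a == b)%:R).
Proof.
have le (b' : mindex d l) i : (b' i <= l)%N by rewrite -ltnS.
have [_] := RI_Y_Psi (le a) (le b).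
rewrite /weight (_ : (fun x => Y _ x * Psi _ x) =
  (fun x => \1_K x * Y (fun i => a i) x * Psi (fun i => b i) x)); last first.
  by apply/funext => x; rewrite -mulrA [RHS]mulrCA Psi_K.
move=> ->; congr (_ * (_ * (nat_of_bool _)%:R)); apply/forallP/eqP => [h|-> //].
by apply/ffunP => i; apply/val_inj/eqP; exact: h.
Qed.

(** Pulling f back by the inverse affine map keeps its degree. Its monomial coefficients, multiplied
    by the factorials in [monom], are the coefficients in the Y_b. *)
Lemma pol_Y (f : 'rV[R]_d -> R) : pol l f -> exists q : mindex d l -> R,
  f = fun x => \sum_(b : mindex d l | (mwt b < l)%N) q b * Y (fun i => b i) x.
Proof.
move=> /(@pol_aff _ _ _ M e)/(pol_coef (leqnSn l))[q qE].
exists (fun b => q b * \prod_i (b i)`!%:R); apply/funext => x.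
rewrite -[in LHS](affK x); have := qE (aff A c x) => /= ->.
apply: eq_bigr => b _; rewrite -mulrA; congr (_ * _).
rewrite /Y /prodf/= -big_split/=; apply: eq_bigr => i _.
by rewrite /monom mulrC divfK// pnatr_eq0 -lt0n fact_gt0.
Qed.

Lemma proj_pol (f : 'rV[R]_d -> R) : pol l f -> sqint f /\ proj f = f.
Proof.
move=> /pol_Y[q fE].
have sw b := weight_sum b (fun b : mindex d l => mwt b < l)%N q (fun b => sqintY (fun i => b i)).
split; first by rewrite fE; have [] := sw (fun=> 0%N).
apply/funext => x; rewrite [RHS](congr1 (fun h => h x) fE) /proj; apply: eq_bigr => b bl.
rewrite [X in weight _ X]fE; have [_ ->] := sw (fun i => b i).
rewrite (bigD1 b)//= weight_Y eqxx big1 ?addr0; last first.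
  by move=> a /andP[_ ab]; rewrite weight_Y (negbTE ab) !mulr0.
(* The signs (-1)^|b| from [proj] and from [weight_Y] cancel. *)
congr (_ * _); have := signr_addb R (odd (mwt b)) (odd (mwt b)); rewrite addbb expr0 !signr_odd => s1.
rewrite (_ : true%:R = 1)// [RHS](_ : _ = q b * ((-1) ^+ mwt b * (-1) ^+ mwt b)); last by rewrite -s1 mulr1.
by field; rewrite gt_eqF.
Qed.

Lemma projB f g x : sqint f -> sqint g -> proj (fun x => f x - g x) x = proj f x - proj g x.
Proof.
move=> sf sg; rewrite /proj -sumrB; apply: eq_bigr => b _; rewrite -mulrBl -mulrBr.
congr (_ * _ * _); rewrite -mulN1r -weightZ// -weightD//; last exact: sqintZ.
by congr weight; apply/funext => z; rewrite mulN1r.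
Qed.

(* The averaged Taylor polynomial of [v] of degree l; [proj] has degree l - 1. *)
Definition primitive (v : 'rV[R]_d -> R) x := \sum_(b : mindex d l | (mwt b < l.+1)%N)
  ((-1) ^+ mwt b / gamma * weight (fun i => b i) v) * Y (fun i => b i) x.

Lemma pol_primitive v : pol l.+1 (primitive v).
Proof.
apply: pol_sum => b bl; apply: polZ; apply: (@leq_pol _ _ (mwt b).+1) => //.
have := @polZ _ _ _ (\prod_i ((b i)`!%:R)^-1) _ (@pol_monomial _ _ A c (fun i => b i)).
congr pol; apply/funext => x; rewrite /Y /prodf/= -big_split/=.
by apply: eq_bigr => i _; rewrite mulrC.
Qed.

(** The conditional guards the truncated subtraction: a factor of exponent 0 is constant and
    contributes nothing to the product rule. *)
Lemma partial_Y b k x : is_derive x (delta_mx 0 k) (Y b)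
  (\sum_j A k j * (if (0 < b j)%N then Y (fun i => b i - (i == j))%N x else 0)).
Proof.
have dm n (t : R) : is_derive t (1 : R) (@monom R n) ((if n is n'.+1 then monom n' else cst 0) t).
  by rewrite -derive1_monom; have [_] := smooth1_derive1 (smooth1_monom R n).
apply: is_derive_eq (is_derive_prodf A c b x k dm) _; apply: eq_bigr => j _; congr (_ * _).
case: ifPn => [bj|]; last first.
  by rewrite -leqNgt leqn0 => /eqP bj; rewrite (bigD1 j)//= eqxx bj mul0r.
apply: eq_bigr => i _; case: eqP => [->|_]; last by rewrite subn0.
by case: (b j) bj => // n _; rewrite subn1.
Qed.

Definition weak_gradient v (g : 'rV[R]_d -> 'rV[R]_d) := forall (b : 'I_d -> nat) k,
  RI (fun x => \1_K x * (v x * partial k (Psi b) x + g x 0 k * Psi b x)) = 0.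

(** Differentiating Y_(b + e_j) contributes A_kj Y_b, so the coefficient of Y_b in d_k P collects
    the weights of v at all b + e_j. Testing the weak gradient with Psi_b identifies that sum with
    minus the weight of g_k at b, and the minus sign is the change from (-1)^|b| to (-1)^(|b| +
    1). *)
Lemma partial_primitive (v : 'rV[R]_d -> R) (g : 'rV[R]_d -> 'rV[R]_d) k x : sqint v -> (forall k, sqint (fun x => g x 0 k)) ->
  weak_gradient v g -> partial k (primitive v) x = proj (fun x => g x 0 k) x.
Proof.
move=> sv sg wg.
have dP : is_derive x (delta_mx 0 k) (primitive v)
    (\sum_(b : mindex d l | (mwt b < l.+1)%N) ((-1) ^+ mwt b / gamma * weight (fun i => b i) v) *
      (\sum_j A k j * (if (0 < b j)%N then Y (fun i => b i - (i == j))%N x else 0))).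
  rewrite (_ : primitive v = \sum_(b : mindex d l | (mwt b < l.+1)%N)
     (((-1) ^+ mwt b / gamma * weight (fun i => b i) v) *: (Y (fun i => b i)))); last first.
    by apply/funext => z; rewrite fct_sumE.
  elim/big_rec2: _ => [|b D f _ dD]; first exact: is_derive_cst.
  exact: (is_deriveD (is_deriveZ _ (partial_Y _ k x)) dD).
rewrite /partial derive_val.
under eq_bigr do rewrite mulr_sumr.
rewrite exchange_big/= /proj.
have wgE (b : mindex d l) : (mwt b < l)%N ->
    weight (fun i => b i) (fun x => g x 0 k) =
    - \sum_j A k j * weight (fun i => incr j b i) v.
  move=> bl; apply/eqP; rewrite -addr_eq0; apply/eqP.
  have ii j := sqint_integrable (fun i => incr j b i) sv.
  have [i1 e1] := @rintegrable_sum _ _ _ (index_enum 'I_d) predT _ (fun j => rintegrableZ (A k j) (ii j)).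
  have e2 : \sum_j A k j * weight (fun i => incr j b i) v =
      RI (fun x => \sum_j A k j * (\1_K x * v x * Psi (fun i => incr j b i) x)).
    by rewrite e1; apply: eq_bigr => j _; rewrite RIZ.
  rewrite e2 /weight -RID//; last exact: sqint_integrable.
  rewrite -[RHS](wg (fun i => b i) k); congr RI; apply/funext => z.
  rewrite /partial (@derive_val _ _ _ _ _ _ _ (partial_prodf A c derive_eta (fun i => b i) k z)).
  rewrite mulrDr addrC; congr (_ + _); last by rewrite -mulrA.
  rewrite mulrA mulr_sumr; apply: eq_bigr => j _; rewrite mulrCA; congr (_ * (_ * _)).
  by congr (prodf eta _ _); apply/funext => i; rewrite incrE.
have -> : \sum_(b : mindex d l | (mwt b < l)%N)
    (-1) ^+ mwt b / gamma * weight (fun i => b i) (fun x => g x 0 k) * Y (fun i => b i) x =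
  \sum_j \sum_(b : mindex d l | (mwt b < l)%N)
     (-1) ^+ mwt b / gamma * (- (A k j * weight (fun i => incr j b i) v)) * Y (fun i => b i) x.
  rewrite exchange_big/=; apply: eq_bigr => b bl; rewrite wgE// -sumrN.
  by rewrite mulr_sumr mulr_suml.
apply: eq_bigr => j _.
rewrite (eq_bigr (fun b : mindex d l => if (0 < b j)%N then (-1) ^+ mwt b / gamma * weight (fun i => b i) v *
   (A k j * Y (fun i => b i - (i == j))%N x) else 0)); last first.
  by move=> b _; case: ifP; rewrite ?mulr0.
rewrite -big_mkcondr/= sum_incr//; apply: eq_bigr => b bl.
rewrite wt_incr// exprS.
rewrite (_ : (fun i => (incr j b i - (i == j))%N) = (fun i => b i : nat)); last first.
  by apply/funext => i; rewrite incrE// addnK.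
by ring.
Qed.


(** * From the definition of the weak gradient to signed integrals, and the error estimate *)

Lemma RI_balanced (F : 'rV[R]_d -> R) : rintegrable F ->
  rint (fun x => (Num.max (F x) 0)%:E) = rint (fun x => (Num.max (- F x) 0)%:E) -> RI F = 0.
Proof.
move=> iF.
have mF := rintegrable_mrow iF.
have iFn : rintegrable (fun x => `|F x|) by have [] := integrable_nonneg_split iF.
have ip : rintegrable (fun x => Num.max (F x) 0).
  apply: rintegrable_le iFn _; first by apply: measurable_maxr => //; exact: measurable_cst.
  by move=> x; rewrite maxEle; case: ifP; rewrite ?normr0.
have im : rintegrable (fun x => Num.max (- F x) 0).
  apply: rintegrable_le iFn _.
    apply: measurable_maxr; last exact: measurable_cst.
    exact: measurableT_comp mF.
  by move=> x; rewrite maxEle; case: ifP; rewrite ?normr0 ?normrN.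
rewrite rint_RI ?rint_RI//; try by move=> x; rewrite le_max lexx orbT.
move=> e0; have {}e0 := EFin_inj e0.
have -> : F = fun x => Num.max (F x) 0 + (- 1) * Num.max (- F x) 0.
  by apply/funext => x; rewrite !maxEle oppr_le0; case: (leP 0 (F x)); case: (leP (F x) 0); lra.
rewrite RID//; last exact: rintegrableZ.
by rewrite RIZ// e0 mulN1r subrr.
Qed.

Lemma sqint_of_intK (f : 'rV[R]_d -> R) : mrow (f : _ -> borel) ->
  (intK K (fun x => (f x ^+ 2)%R) < +oo)%E -> sqint f.
Proof.
move=> mf fin; split => //; apply: rint_integrable => //.
- apply: measurable_funM; first exact: mrow_indicK.
  exact: measurable_funX.
- by move=> x; have /andP[k0 _] := indic01 x; rewrite mulr_ge0// sqr_ge0.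
Qed.

Lemma sqint_of_intK_sum (g : 'I_d -> 'rV[R]_d -> R) k : (forall i, mrow (g i : _ -> borel)) ->
  (intK K (fun x => (\sum_i g i x ^+ 2)%R) < +oo)%E -> sqint (g k).
Proof.
move=> mg fin; split => //.
have ig : rintegrable (fun x => \1_K x * \sum_i g i x ^+ 2).
  apply: rint_integrable => //.
  - apply: measurable_funM; first exact: mrow_indicK.
    by apply: measurable_sum => i; apply: measurable_funX; exact: mg.
  - move=> x; have /andP[k0 _] := indic01 x; rewrite mulr_ge0// sumr_ge0// => i _; exact: sqr_ge0.
apply: rintegrable_le ig _.
  apply: measurable_funM; first exact: mrow_indicK.
  by apply: measurable_funX; exact: mg.
move=> x; have /andP[k0 _] := indic01 x.
rewrite ger0_norm ?(mulr_ge0 k0 (sqr_ge0 _))// ler_wpM2l// (bigD1 k)//= lerDl.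
by apply: sumr_ge0 => i _; exact: sqr_ge0.
Qed.

Lemma H1_weak_gradient (v : 'rV[R]_d -> R) (g : 'rV[R]_d -> 'rV[R]_d) : H1_weak_grad K v g ->
  [/\ sqint v, (forall k, sqint (fun x => g x 0 k)) & weak_gradient v g].
Proof.
move=> [mv mg fv fg wg].
have sv : sqint v by exact: sqint_of_intK.
have sg k : sqint (fun x => g x 0 k).
  exact: (sqint_of_intK_sum (g := fun i x => g x 0 i) k mg fg).
split=> // b k.
have tf : test_fun K (Psi b).
  apply: (prodf_test_fun derive_eta rr' supported_eta affK affK') => x h.
  by apply/KK0/K0_ball.
have pE x : partial k (Psi b) x = \sum_j A k j * (Psi (shift_index j b)) x.
  by rewrite /partial (@derive_val _ _ _ _ _ _ _ (partial_prodf A c derive_eta b k x)).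
have iF : rintegrable (fun x => \1_K x * (v x * partial k (Psi b) x + g x 0 k * Psi b x)).
  rewrite (_ : (fun x => _) = fun x => \sum_j A k j * (\1_K x * v x * Psi (shift_index j b) x)
      + \1_K x * g x 0 k * Psi b x); last first.
    apply/funext => x; rewrite pE mulrDr !mulrA; congr (_ + _); rewrite mulr_sumr.
    by apply: eq_bigr => j _; rewrite mulrCA.
  apply: rintegrableD; last exact: sqint_integrable.
  have [] // := @rintegrable_sum R d _ (index_enum 'I_d) predT (fun j x => A k j * (\1_K x * v x * Psi (shift_index j b) x)).
  by move=> j; apply: rintegrableZ; exact: sqint_integrable.
apply: (RI_balanced iF).
(* The indicator is nonnegative, so it passes inside the positive part; [intK] multiplies by it
   outside. *)
have mx x (z : R) : \1_K x * Num.max z 0 = Num.max (\1_K x * z) 0.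
  by have /andP[k0 _] := indic01 x; rewrite maxr_pMr// mulr0.
have := wg _ tf k; rewrite /intK /rint => e0.
rewrite (_ : (_ \o _) = (fun t : d.-tuple R => (\1_K (row_of_tuple t) * Num.max (v (row_of_tuple t) * partial k (Psi b) (row_of_tuple t) + g (row_of_tuple t) 0 k * Psi b (row_of_tuple t)) 0)%:E)).
  rewrite e0; congr iint; apply/funext => t /=.
  by rewrite mx mulrN.
by apply/funext => t /=; rewrite mx.
Qed.

(** From (f - Pi f)^2 <= 2 f^2 + 2 (Pi f)^2. It depends on [Beta], d, l and K0, but not on the
    affine map or on gamma, which is what makes the final constant uniform in K. *)
Definition err_const : R := 2 + 2 * proj_const.

Lemma err_const_gt0 : 0 < err_const.
Proof. by rewrite ltr_pwDl// mulr_ge0// sqr_ge0. Qed.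

Lemma sqint_intK_sum (g : 'I_d -> 'rV[R]_d -> R) : (forall i, sqint (g i)) ->
  intK K (fun x => \sum_i g i x ^+ 2) = (\sum_i RI (fun x => \1_K x * g i x ^+ 2))%:E.
Proof.
move=> sg.
have e0 : (fun x => \1_K x * \sum_i g i x ^+ 2) = fun x => \sum_i \1_K x * g i x ^+ 2.
  by apply/funext => x; rewrite mulr_sumr.
have [ig eg] := @rintegrable_sum R d _ (index_enum 'I_d) predT (fun i x => \1_K x * g i x ^+ 2) (fun i => (sg i).2).
rewrite -eg -rint_RI//.
  by rewrite /intK /rint; congr iint; apply/funext => t /=; rewrite mulr_sumr.
by move=> x; apply: sumr_ge0 => i _; have /andP[k0 _] := indic01 x; rewrite (mulr_ge0 k0 (sqr_ge0 _)).
Qed.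

Lemma err_le_err_low (v : 'rV[R]_d -> R) (g : 'rV[R]_d -> 'rV[R]_d) : H1_weak_grad K v g ->
  (err l K g <= (err_const `^ 2^-1)%:E * err_low l K g)%E.
Proof.
move=> /H1_weak_gradient[sv sg wg].
have c0 : 0 < err_const `^ 2^-1 by rewrite powR_gt0// err_const_gt0.
(* The constant is moved to the left so that the infimum over Q can be tested one Q at a time; each
   Q is compared with the same polynomial [primitive v]. *)
rewrite -lee_pdivrMl//; apply: le_ereal_inf_tmp => _ [Q /= Qpol <-]; rewrite lee_pdivrMl//.
have pQ k : pol l (Q k) by apply: (is_poly_pol _ (Qpol k)); rewrite ltrBlDr ltrDl.
have sQ k : sqint (Q k) by have [] := proj_pol (pQ k).
have sN f : sqint f -> sqint (fun x => - f x).
  by move=> /(sqintZ (-1)); congr sqint; apply/funext => x; rewrite mulN1r.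
pose f k x := g x 0 k - Q k x.
have sf k : sqint (f k) by apply: sqintD => //; exact: sN.
have spf k : sqint (proj (f k)) by have [] := proj_bounded (sf k).
have sh k : sqint (fun x => f k x - proj (f k) x) by apply: sqintD => //; exact: sN.
apply: ge_ereal_inf; exists (Defs.sqrte (intK K (fun x => \sum_i (g x 0 i - partial i (primitive v) x) ^+ 2))).
  exists (primitive v) => //; apply: pol_is_poly; exact: pol_primitive.
(* Since Pi fixes Q_i, subtracting Q_i changes nothing: g_i - Pi g_i = f_i - Pi f_i with f_i = g_i -
   Q_i. *)
have -> : (fun x => \sum_i (g x 0 i - partial i (primitive v) x) ^+ 2) =
    (fun x => \sum_i (f i x - proj (f i) x) ^+ 2).
  apply/funext => x; apply: eq_bigr => k _; congr (_ ^+ 2).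
  rewrite (partial_primitive k x sv sg wg) /f projB// (proj_pol (pQ k)).2; ring.
rewrite (sqint_intK_sum sh) (sqint_intK_sum sf) /Defs.sqrte !poweR_EFin -EFinM lee_fin.
set X := \sum_i _; set Z := \sum_i _.
have Z0 : 0 <= Z.
  apply: sumr_ge0 => i _; apply: RI_ge0 => x.
  by have /andP[k0 _] := indic01 x; rewrite (mulr_ge0 k0 (sqr_ge0 _)).
have X0 : 0 <= X.
  apply: sumr_ge0 => i _; apply: RI_ge0 => x.
  by have /andP[k0 _] := indic01 x; rewrite (mulr_ge0 k0 (sqr_ge0 _)).
rewrite -powRM ?(ltW err_const_gt0)//; apply: ge0_ler_powR; rewrite ?nnegrE ?mulr_ge0 ?(ltW err_const_gt0)//.
rewrite /X /Z mulr_sumr; apply: ler_sum => k _.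
have [_ pb] := proj_bounded (sf k).
apply: (@le_trans _ _ (2 * RI (fun x => \1_K x * f k x ^+ 2) + 2 * RI (fun x => \1_K x * proj (f k) x ^+ 2))); last first.
  by rewrite /err_const; nra.
rewrite -!RIZ; [|exact: (spf k).2|exact: (sf k).2].
have i1 := rintegrableZ 2 (sf k).2; have i2 := rintegrableZ 2 (spf k).2.
rewrite -RID//; apply: le_RI; [exact: (sh k).2|exact: rintegrableD|].
move=> x; have /andP[k0 _] := indic01 x.
rewrite [leRHS](_ : _ = \1_K x * (2 * f k x ^+ 2 + 2 * proj (f k) x ^+ 2)); last by ring.
rewrite ler_wpM2l//.
by have := sqr_ge0 (f k x + proj (f k) x); nra.
Qed.

End Projection.

(** * The reference simplex *)

Lemma smooth1_bounded (R : realType) (r : R) (f : R -> R) : 0 < r -> smooth1 f ->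
  supported r f -> exists B, forall x, `|f x| <= B.
Proof.
move=> r0 sf rf; have ab : - r <= r by lra.
have cf := smooth1_continuous sf.
have cn : continuous (fun x => `|f x|).
  by move=> x; apply: continuous_comp; [exact: cf|exact: (@norm_continuous _ R^o)].
have [c _ fc] := EVT_max ab (continuous_subspaceT cn).
exists `|f c| => x; have [rx|rx] := leP `|x| r; last by rewrite rf// normr0.
by apply: fc; rewrite in_itv/= -ler_norml.
Qed.

Section ReferenceSimplex.
Context {R : realType} {d : nat}.
Local Notation borel := (measurableTypeR R).

Definition bary : R := d.+1%:R^-1.

(* The standard simplex, translated so that its barycenter is the origin. *)
Definition ref_simplex : set 'rV[R]_d :=
  [set y | (forall i, 0 <= y 0 i + bary) /\ \sum_i (y 0 i + bary) <= 1].

Lemma bary_gt0 : 0 < bary. Proof. by rewrite invr_gt0 ltr0n. Qed.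

Lemma bary_le1 : bary <= 1. Proof. by rewrite invf_le1 ?ltr0n// ler1n. Qed.

Lemma ref_simplex_le1 (y : 'rV[R]_d) i : ref_simplex y -> `|y 0 i| <= 1.
Proof.
move=> [y0 y1]; have b0 := bary_gt0; have b1 := bary_le1; have yi := y0 i.
have : y 0 i + bary <= 1.
  by apply: le_trans y1; rewrite (bigD1 i)//= lerDl sumr_ge0.
by move=> ?; rewrite ler_norml; apply/andP; split; lra.
Qed.

(** With beta = 1 / (d + 1), a coordinate stays nonnegative because beta^2 <= beta, and the sum is
    at most d (beta^2 + beta) = 1 - beta^2. *)
Lemma ref_simplex_ball (y : 'rV[R]_d) : (forall i, `|y 0 i| < bary ^+ 2) -> ref_simplex y.
Proof.
move=> yb; have b0 := bary_gt0; have b1 := bary_le1.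
have yb2 i : - bary ^+ 2 <= y 0 i <= bary ^+ 2 by rewrite -ler_norml ltW.
split=> [i|]; first by have /andP[] := yb2 i; nra.
apply: (@le_trans _ _ (\sum_(i < d) (bary ^+ 2 + bary))).
  by apply: ler_sum => i _; rewrite lerD2r; have /andP[] := yb2 i.
rewrite sumr_const card_ord -mulr_natr.
have bd : bary * (d%:R + 1) = 1 by rewrite natr1 mulVf// pnatr_eq0.
have -> : (bary ^+ 2 + bary) * d%:R = bary * (bary * (d%:R + 1)) - bary ^+ 2 + bary * (d%:R + 1) - bary by ring.
by rewrite bd mulr1; nra.
Qed.

Lemma mrow_ref_simplex : mrow (\1_ref_simplex : 'rV[R]_d -> borel).
Proof.
pose p (y : 'rV[R]_d) := all (fun i => 0 <= y 0 i + bary) (index_enum 'I_d) && (\sum_i (y 0 i + bary) <= 1).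
have mc i : measurable_fun (setT : set (d.-tuple borel)) (fun t => (row_of_tuple t 0 i + bary : borel)).
  by apply: measurable_funD; [exact: mrow_coord|exact: measurable_cst].
have mp : measurable_fun (setT : set (d.-tuple borel)) (fun t => p (row_of_tuple t)).
  apply: measurable_and; last by apply: measurable_fun_ler; [exact: measurable_sum|exact: measurable_cst].
  elim: (index_enum _) => [|i s IH] /=; first exact: measurable_cst.
  by apply: measurable_and => //; apply: measurable_fun_ler; [exact: measurable_cst|exact: mc].
rewrite (_ : \1_ref_simplex = fun y => if p y then 1 else 0).
  by apply: measurable_fun_ifT => //; exact: measurable_cst.
apply/funext => y; rewrite indicE.
have -> : (y \in ref_simplex) = p y; last by case: (p y).
apply/idP/idP; rewrite ?inE.
  by move=> [y0 y1]; apply/andP; split=> //; apply/allP => i _.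
by move=> /andP[/allP y0 y1]; split=> // i; apply: y0; rewrite mem_index_enum.
Qed.

(** The simplex lies in the cube [-1, 1]^d, whose indicator is a product of one-dimensional
    indicators. *)
Lemma rintegrable_ref_simplex : rintegrable (\1_ref_simplex : 'rV[R]_d -> R).
Proof.
pose f (i : 'I_d) : R -> R := \1_(`[(-1)%R, 1%R]).
have [ib _] := @integral_prod R d f (fun i => integrable_indic_itv (-1) 1 true false).
pose G (y : 'rV[R]_d) := \prod_i f i (y 0 i).
have iG : rintegrable G.
  rewrite /rintegrable (_ : G \o _ = fun t => \prod_i f i (tnth t i))//.
  by apply/funext => t; apply: eq_bigr => i _; rewrite mxE.
apply: (rintegrable_le mrow_ref_simplex iG) => y.
have G0 : 0 <= G y by apply: prodr_ge0 => i _; rewrite /f indicE.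
rewrite indicE; have [|] := boolP (y \in ref_simplex); last by rewrite normr0.
rewrite inE => yK; rewrite normr1 /G big1// => i _; rewrite /f indicE mem_set//=.
by rewrite in_itv/= -ler_norml; exact: ref_simplex_le1.
Qed.

End ReferenceSimplex.
Arguments bary : clear implicits.

Lemma simplex_ref (R : realType) (d : nat) (a : 'I_d.+1 -> 'rV[R]_d) : affine_indep a ->
  exists A M c e, [/\ M \in unitmx, cancel (aff A c) (aff M e), cancel (aff M e) (aff A c) &
    forall x, simplex a x <-> ref_simplex (aff A c x)].
Proof.
rewrite /affine_indep; set M := \matrix_(i < d) _ => detM.
have Mu : M \in unitmx by rewrite unitmxE unitfE.
(* The rows of M are the edges from [a ord0], so e is the barycenter, and the coordinates of
   [aff A c x] shifted by [bary] are the barycentric coordinates of x at the other vertices. *)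
pose e := a ord0 + const_mx (bary R d) *m M.
pose A := invmx M; pose c := - (e *m A).
have AK : cancel (aff A c) (aff M e).
  by move=> x; rewrite /aff /c mulmxDl mulNmx !mulmxKV// subrK.
have AK' : cancel (aff M e) (aff A c).
  by move=> y; rewrite /aff /c mulmxDl mulmxK// addrK.
exists A, M, c, e; split=> // x.
have ME (y : 'rV[R]_d) : aff M e y = a ord0 + \sum_i (y 0 i + bary R d) *: (a (lift ord0 i) - a ord0).
  rewrite /aff /e addrCA -mulmxDl mulmx_sum_row; congr (_ + _).
  by apply: eq_bigr => i _; rewrite rowK !mxE.
split=> [[lam [l0 l1 xE]]|[y0 y1]].
  pose y : 'rV[R]_d := \row_i (lam (lift ord0 i) - bary R d).
  have yE i : y 0 i + bary R d = lam (lift ord0 i) by rewrite mxE subrK.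
  have -> : aff A c x = y.
    rewrite -[RHS]AK'; congr aff; rewrite ME xE big_ord_recl.
    under [in RHS]eq_bigr do rewrite yE scalerBr.
    rewrite sumrB -scaler_suml addrCA addrC; congr (_ + _).
    rewrite -[X in _ = X - _]scale1r -scalerBl; congr (_ *: _).
    by move: l1; rewrite big_ord_recl => <-; rewrite addrK.
  split=> [i|]; first by rewrite yE.
  under eq_bigr do rewrite yE.
  by move: l1; rewrite big_ord_recl => <-; rewrite lerDr.
set y := aff A c x in y0 y1.
pose lam i := if unlift ord0 i is Some j then y 0 j + bary R d else 1 - \sum_j (y 0 j + bary R d).
have lam0 : lam ord0 = 1 - \sum_j (y 0 j + bary R d) by rewrite /lam unlift_none.
have lamS j : lam (lift ord0 j) = y 0 j + bary R d by rewrite /lam liftK.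
exists lam; split.
- by move=> i; case: (unliftP ord0 i) => [j|] ->; rewrite ?lamS ?lam0 ?subr_ge0.
- by rewrite big_ord_recl lam0; under [X in _ + X]eq_bigr do rewrite lamS; rewrite subrK.
- rewrite big_ord_recl lam0; under [X in _ = _ + X]eq_bigr do rewrite lamS.
  rewrite -[LHS]AK -/y ME; under [in LHS]eq_bigr do rewrite scalerBr.
  by rewrite sumrB -scaler_suml scalerBl scale1r addrCA addrC.
Qed.

Theorem theorem3p6 (R : realType) (d l : nat) :
  exists C : R, forall (a : 'I_d.+1 -> 'rV[R]_d), affine_indep a ->
    forall (v : 'rV[R]_d -> R) (g : 'rV[R]_d -> 'rV[R]_d),
      H1_weak_grad (simplex a) v g ->
      (err l (simplex a) g <= C%:E * err_low l (simplex a) g)%E.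
Proof.
(* Half the radius of the cube inside the reference simplex, which leaves the gap that compact
   support in the interior demands. The kernels and their bounds are fixed here, before the simplex
   is given. *)
pose r : R := bary R d ^+ 2 / 2.
have r0 : 0 < r by rewrite divr_gt0// exprn_gt0// bary_gt0.
have [eta [seta deta supeta meta]] := exists_moment_kernel l r0.
have [Beta bBeta] := choice (fun b => smooth1_bounded r0 (seta b) (supeta b)).
exists (@err_const R d l Beta ref_simplex `^ 2^-1) => a /simplex_ref[A [M [c [e [Mu AK AK' aK]]]]] v g vg.
have [gamma sc] := affine_volume_scaling e Mu.
have rr' : r < bary R d ^+ 2 by rewrite /r ltr_pdivrMr// ltr_pMr ?ltr1n// exprn_gt0// bary_gt0.
exact: (err_le_err_low seta deta supeta meta bBeta AK AK' sc aK mrow_ref_simplex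
  rintegrable_ref_simplex ref_simplex_le1 rr' ref_simplex_ball vg).
Qed.
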